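(* Let the support of the law $P_{\xi_0}$ of the initial condition be contained in the compact set $K\subset\mathbb{R}^d$. Let the sampling times $0\le t_1\le\dots\le t_{\bar N}=T$ satisfy $t_i-t_{i-1}\le\Delta$ for all $i\in\{2,\dots,\bar N\}$, for some $\Delta>0$. Let $N^\flat\in\{1,\dots,\bar N\}$, $N:=\bar N-N^\flat+1$, and $$\bar P^N_{\xi_T}:=\frac1N\sum_{i=N^\flat}^{\bar N}\delta_{\bar\xi^i_T},\qquad \bar\xi^i_T:=\Phi^{\mathrm{num}}_{T,t_i}(\xi^i_{t_i}).$$ Then, for any $\beta\in(0,1)$ and $p\ge1$, $$\mathbb P\big(W_p(\bar P^N_{\xi_T},P_{\xi_T})\le\psi_N(\beta,\Delta)\big)\ge1-\beta,$$ where $$\psi_N(\beta,\Delta):=\varepsilon_N(\beta,\rho_T)+\bar\varepsilon_N(\Delta),\qquad \bar\varepsilon_N(\Delta):=\mathfrak K\Big(\frac1N\int_1^N(e^{L\Delta s}-1)^p\,ds\Big)^{1/p},$$ and $\rho_T:=\frac12\operatorname{diam}(\Phi_T(K))$.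
   Context: Dynamics: $\dot\xi_t=F(t,\xi_t)$, $\xi_t\in\mathbb{R}^d$, where $F$ is continuous, locally Lipschitz in $\xi$, and the system is forward complete. For $t\ge s\ge 0$, $\Phi_{t,s}(\xi)$ denotes the value at time $t$ of the solution equal to $\xi$ at time $s$; $\Phi_t:=\Phi_{t,0}$. Random data: on a probability space $(\Omega,\mathcal F,\mathbb P)$, the initial conditions $\xi_0^i$, $i=1,\dots,\bar N$, are i.i.d. with law $P_{\xi_0}$; $\xi^i_t:=\Phi_t(\xi_0^i)$ are the corresponding independent trajectories, with common law $P_{\xi_t}:=\Phi_{t\#}P_{\xi_0}$. From trajectory $\xi^i$ the full-state sample $\xi^i_{t_i}$ is collected at the (deterministic) time $t_i$. Numerical flow: $\Phi^{\mathrm{num}}_{t,s}:\mathbb R^d\to\mathbb R^d$, $0\le s\le t\le T$, is an approximation of the flow for which there are constants $\mathfrak K,L>0$ with $$\|\Phi^{\mathrm{num}}_{t,s}(\xi)-\Phi_{t,s}(\xi)\|\le\mathfrak K(e^{L(t-s)}-1)\quad\text{for all }0\le s\le t\le T,\ \xi\in\Phi_s(K).$$ $\|\cdot\|$ is the Euclidean norm, $\operatorname{diam}(S):=\sup\{\|x-y\|_\infty: x,y\in S\}$, and $W_p$ is the $p$-Wasserstein distance on probability measures on $\mathbb{R}^d$ with finite $p$-th moment, defined with the Euclidean cost $\|x-y\|^p$. Radius: let $C,c>0$ be constants depending only on $p$ and $d$ such that for every i.i.d. sequence $(X_i)$ in $\mathbb{R}^d$ with compactly supported law $\mu$, with $\rho:=\frac12\operatorname{diam}(\operatorname{supp}\mu)>0$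 and $\widehat\mu^N:=\frac1N\sum_{i=1}^N\delta_{X_i}$, and all $N\ge1$, $\varepsilon>0$, one has $\mathbb P(W_p^p(\widehat\mu^N,\mu)\ge\varepsilon)\le\chi_N(\varepsilon,\rho)$, where $\chi_N(\varepsilon,\rho)$ equals $Ce^{-cN\varepsilon^2/\rho^{2p}}$ if $p>d/2$, $C\exp\big(-cN\frac{\varepsilon^2}{\rho^{2p}(\ln(2+\rho^p/\varepsilon))^2}\big)$ if $p=d/2$, and $Ce^{-cN\varepsilon^{d/p}/\rho^d}$ if $p<d/2$. Then $$\varepsilon_N(\beta,\rho):=\begin{cases}\left(\frac{\ln(C\beta^{-1})}{c}\right)^{\frac1{2p}}\frac{\rho}{N^{1/(2p)}}, & p>d/2,\\ \left[h^{-1}\left(\frac{\ln(C\beta^{-1})}{cN}\right)\right]^{\frac1p}\rho, & p=d/2,\\ \left(\frac{\ln(C\beta^{-1})}{c}\right)^{\frac1d}\frac{\rho}{N^{1/d}}, & p<d/2,\end{cases}$$ with $h^{-1}$ the inverse of $h(x)=\frac{x^2}{(\ln(2+1/x))^2}$, $x>0$. *)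

(* Defs.v *)
From HB Require Import structures.
From mathcomp Require Import all_boot all_order all_algebra.
From mathcomp Require Import all_classical all_reals all_analysis.

Set Implicit Arguments.
Unset Strict Implicit.
Unset Printing Implicit Defensive.

Import Order.TTheory GRing.Theory Num.Theory.
Import numFieldNormedType.Exports.

Local Open Scope classical_set_scope.
Local Open Scope ring_scope.

(* R^d is 'rV[R]_d; its library norm `|x| is the sup norm and its topology the
   usual one.  It is given the Borel sigma-algebra. *)
Section borel_rV.
Context (R : realType) (d : nat).

Let borel : set (set 'rV[R]_d) := <<s @open 'rV[R]_d >>.

Let borel0 : borel set0. Proof. exact: sigma_algebra0. Qed.

Let borelC A : borel A -> borel (~` A). Proof. exact: sigma_algebraC. Qed.

Let borel_bigcup (A : (set 'rV[R]_d)^nat) :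
  (forall i, borel (A i)) -> borel (\bigcup_i A i).
Proof. exact: sigma_algebra_bigcup. Qed.

HB.instance Definition _ := @isMeasurable.Build
  (sigma_display (@open 'rV[R]_d)) 'rV[R]_d borel borel0 borelC borel_bigcup.

End borel_rV.

Definition enorm (R : realType) (d : nat) (x : 'rV[R]_d) : R :=
  Num.sqrt (\sum_(i < d) x ord0 i ^+ 2).

Definition diam (R : realType) (d : nat) (S : set 'rV[R]_d) : R :=
  sup [set `|z.1 - z.2| | z in S `*` S].

Definition supp (R : realType) (d : nat) (mu : set 'rV[R]_d -> \bar R) :
    set 'rV[R]_d :=
  [set x | forall U, open U -> U x -> (0 < mu U)%E].

(* Only the values of F at times t >= 0 matter. *)
Definition continuous_field (R : realType) (d : nat)
    (F : R -> 'rV[R]_d -> 'rV[R]_d) : Prop :=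
  {within [set z : R * 'rV[R]_d | 0 <= z.1], continuous (fun z => F z.1 z.2)}.

(* The Lipschitz constant is uniform for t near t0, as uniqueness of solutions
   requires. *)
Definition locally_lipschitz_field (R : realType) (d : nat)
    (F : R -> 'rV[R]_d -> 'rV[R]_d) : Prop :=
  forall (t0 : R) (x0 : 'rV[R]_d), 0 <= t0 ->
  exists2 V : set (R * 'rV[R]_d), nbhs (t0, x0) V &
  exists l : R, forall t x y, 0 <= t -> V (t, x) -> V (t, y) ->
    `|F t x - F t y| <= l * `|x - y|.

(* x solves x' = F(t, x) on [s, +oo[ with x(s) = x0.  For continuous F the
   one-sided derivative at s is then F(s, x0). *)
Definition solution (R : realType) (d : nat) (F : R -> 'rV[R]_d -> 'rV[R]_d)
    (s : R) (x0 : 'rV[R]_d) (x : R -> 'rV[R]_d) : Prop :=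
  [/\ x s = x0,
      {within `[s, +oo[, continuous x} &
      forall t : R, s < t -> is_derive t (1 : R) x (F t (x t))].

Definition forward_complete (R : realType) (d : nat)
    (F : R -> 'rV[R]_d -> 'rV[R]_d) : Prop :=
  forall (s : R) (x0 : 'rV[R]_d), 0 <= s -> exists x, solution F s x0 x.

(* Meaningful for 0 <= s <= t, where all solutions selectable by xget agree. *)
Definition flow (R : realType) (d : nat) (F : R -> 'rV[R]_d -> 'rV[R]_d)
    (t s : R) (x0 : 'rV[R]_d) : 'rV[R]_d :=
  xget (cst x0) [set x | solution F s x0 x] t.

(* Marginals are compared on measurable sets, so mu and nu need not be bundled
   as measures. *)
Definition coupling (R : realType) (d : nat) (mu nu : set 'rV[R]_d -> \bar R)
    (pi : probability ('rV[R]_d * 'rV[R]_d)%type R) : Prop :=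
  forall A : set 'rV[R]_d, measurable A ->
    pi (A `*` setT) = mu A /\ pi (setT `*` A) = nu A.

Definition wasserstein (R : realType) (d : nat) (p : R)
    (mu nu : set 'rV[R]_d -> \bar R) : \bar R :=
  (ereal_inf [set \int[pi]_z (enorm (z.1 - z.2) `^ p)%:E
             | pi in coupling mu nu] `^ p^-1)%E.

(* The uniform distribution on the points x_m, ..., x_n. *)
Definition empirical (R : realType) (d : nat) (m n : nat)
    (x : nat -> 'rV[R]_d) (A : set 'rV[R]_d) : \bar R :=
  (((n - m + 1)%N%:R^-1 : R)%:E * \sum_(m <= i < n.+1) \d_(x i) A)%E.

(* X_1, ..., X_n are independent with law mu. *)
Definition iid (R : realType) (d : nat) (disp : measure_display)
    (Omega : measurableType disp) (P : probability Omega R)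
    (mu : probability 'rV[R]_d R) (n : nat)
    (X : nat -> {mfun Omega >-> 'rV[R]_d}) : Prop :=
  (forall i, (1 <= i <= n)%N -> forall A : set 'rV[R]_d, measurable A ->
     distribution P (X i) A = mu A) /\
  (forall (J : seq nat) (A : nat -> set 'rV[R]_d), uniq J ->
     (forall i, i \in J -> (1 <= i <= n)%N) ->
     (forall i, i \in J -> measurable (A i)) ->
     P (\bigcap_(i in [set` J]) (X i @^-1` A i)) =
     (\prod_(i <- J) P (X i @^-1` A i))%E).

Definition chi (R : realType) (d : nat) (p C c : R) (N : nat) (eps rho : R) :
    R :=
  if d%:R / 2 < p then
    C * expR (- c * N%:R * (eps ^+ 2 / rho `^ (2 * p)))
  else if p == d%:R / 2 then
    C * expR (- c * N%:R *
      (eps ^+ 2 / (rho `^ (2 * p) * ln (2 + rho `^ p / eps) ^+ 2)))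
  else C * expR (- c * N%:R * (eps `^ (d%:R / p) / rho ^+ d)).

(* Only X_1, ..., X_N enter the bound, so independence is required of these
   variables only. *)
Definition concentration_constants (R : realType) (d : nat) (p C c : R) :
    Prop :=
  forall (disp : measure_display) (Omega : measurableType disp)
    (P : probability Omega R) (mu : probability 'rV[R]_d R)
    (X : nat -> {mfun Omega >-> 'rV[R]_d}) (N : nat) (eps : R),
  let rho := diam (supp mu) / 2 in
  compact (supp mu) -> 0 < rho -> (1 <= N)%N -> 0 < eps ->
  iid P mu N X ->
  (P [set w | (eps%:E <=
         wasserstein p (empirical 1 N (fun i => X i w)) mu `^ p)%E]
   <= (chi d p C c N eps rho)%:E)%E.

(* hfun is an increasing bijection of ]0, +oo[ onto itself. *)
Definition hfun (R : realType) (x : R) : R := x ^+ 2 / ln (2 + 1 / x) ^+ 2.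

Definition hinv (R : realType) : R -> R :=
  'pinv_(fun=> 0) [set x : R | 0 < x] (@hfun R).

Definition eps_radius (R : realType) (d : nat) (p C c : R) (N : nat)
    (beta rho : R) : R :=
  let l := ln (C * beta^-1) in
  if d%:R / 2 < p then
    (l / c) `^ (1 / (2 * p)) * (rho / N%:R `^ (1 / (2 * p)))
  else if p == d%:R / 2 then
    hinv (l / (c * N%:R)) `^ (1 / p) * rho
  else (l / c) `^ (1 / d%:R) * (rho / N%:R `^ (1 / d%:R)).

Definition bar_eps (R : realType) (p Kf L : R) (N : nat) (Delta : R) : R :=
  Kf * (N%:R^-1 *
    \int[@lebesgue_measure R]_(s in `[1, N%:R])
      ((expR (L * Delta * s) - 1) `^ p)) `^ (1 / p).

Definition psi (R : realType) (d : nat) (p C c Kf L : R) (N : nat)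
    (beta rho Delta : R) : R :=
  eps_radius d p C c N beta rho + bar_eps p Kf L N Delta.

(* Inner probability, for events whose measurability is not guaranteed; it is
   P E when E is measurable. *)
Definition inner_prob (R : realType) (disp : measure_display)
    (Omega : measurableType disp) (P : probability Omega R) (E : set Omega) :
    \bar R :=
  ereal_sup [set P A | A in [set A | measurable A /\ A `<=` E]].

Lemma inner_prob_measurable (R : realType) (disp : measure_display)
    (Omega : measurableType disp) (P : probability Omega R) (E : set Omega) :
  measurable E -> inner_prob P E = P E.
Proof.
move=> mE; apply/eqP; rewrite eq_le; apply/andP; split.
  apply: ge_ereal_sup => _ [A [mA AE] <-].
  exact: le_measure (mem_set mA) (mem_set mE) AE.
by apply: ereal_sup_ubound; exists E => //; split.
Qed.

(* Main.v *)
Require Import Defs.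
From HB Require Import structures.
From mathcomp Require Import all_boot all_order all_algebra.
From mathcomp Require Import all_classical all_reals all_analysis.
From mathcomp Require Import measurable_realfun lra ring zify.

Import Order.TTheory GRing.Theory Num.Theory.
Import numFieldNormedType.Exports.

Local Open Scope classical_set_scope.
Local Open Scope ring_scope.

(** The exact flow takes the sample of trajectory [i], collected at time [t i], to
[Phi_T (xi0 i)], so the exactly propagated samples are i.i.d. with law
[P_{xi_T}], the image of the initial law under [Phi_T].  The triangle inequality
for [W_p] splits the error in two.

The distance from the empirical measure of the exact points to [P_{xi_T}] is
controlled by the concentration inequality ([concentration_event]): the radius
is the solution of [chi (eps ^ p) = beta] ([chi_eps_radius]), and it grows with
[rho], while the support of [P_{xi_T}] lies in [Phi_T (K)].  Solving for the
radius requires [beta < C].  This holds as soon as the support has two points,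
because one sample then stays at a fixed distance from the law, so that the
inequality with a small deviation forces [1 <= C]
([concentration_constant_ge1]).  A law supported by one point is equal to its
empirical measures almost surely.

The distance between the empirical measures of the exact and of the numerical
points is at most the [L^p] mean of the numerical errors, and the sum of these
errors is compared with the integral of an increasing function
([mean_flow_error_le]).

Both uses of the triangle inequality are the single lemma [wasserstein_move]:
moving the atoms of a uniform measure changes its distance to any law by at most
the [L^p] mean of the displacements.  It is proved by rerouting a coupling:
the mass that a coupling takes from an atom is shared equally among the indices
located at this atom, and each share is taken to the new position of its index.
The same lemma makes the distance continuous in the positions of the atoms,
whence the measurability of the deviation event ([measurable_wasserstein_lt]).

The facts on the flow, namely uniqueness, the semigroup law and continuity in
the initial condition, all come from one Gronwall estimate
([solution_stability]). *)

Set Implicit Arguments.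
Unset Strict Implicit.
Unset Printing Implicit Defensive.

(** * The flow of the differential equation *)

Section flow.
Context (R : realType) (d : nat).
Implicit Types (F : R -> 'rV[R]_d -> 'rV[R]_d) (x y : R -> 'rV[R]_d).

(** Local Lipschitz constants become uniform along a solution by compactness of
the time interval.  Near-covering is applied to the filter of pairs (small
radius, large constant), so that one pair serves all times. *)
Lemma lipschitz_tube F (s T : R) x :
  locally_lipschitz_field F -> 0 <= s -> {within `[s, T], continuous x} ->
  exists e l : R, [/\ 0 < e, 0 < l & forall t, t \in `[s, T] -> forall z,
    `|z - x t| < e -> `|F t z - F t (x t)| <= l * `|z - x t|].
Proof.
move=> Flip s0 cx.
pose P (el : R * R) (t : R) := forall z, `|z - x t| < el.1 ->
  `|F t z - F t (x t)| <= el.2 * `|z - x t|.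
have : \forall el \near filter_prod (0 : R)^'+ (pinfty_nbhs R), `[s, T] `<=` P el.
  have /compact_near_coveringP/near_covering_withinP := @segment_compact R s T.
  apply => t0 t0I.
  have t00 : 0 <= t0 by move: t0I; rewrite /= in_itv /= => /andP[/(le_trans s0)].
  have [V /nbhs_ballP [dl /= dl0 dlV] [l0 Hl]] := Flip t0 (x t0) t00.
  have /subspace_continuousP/(_ _ t0I)/cvgrPdist_lt/(_ (dl / 2)) := cx.
  rewrite divr_gt0// => /(_ isT) cxt.
  rewrite near_withinE in cxt.
  have near_t0 : \forall t \near t0, `|t0 - t| < dl.
    by have := nbhsx_ballx t0 dl dl0; rewrite -ball_normE.
  have near_el : \forall el \near filter_prod (0 : R)^'+ (pinfty_nbhs R),
      el.1 < dl / 2 /\ l0 <= el.2.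
    exists ([set e | e < dl / 2], [set e | l0 <= e]) => //=; split.
      by apply: nbhs_right_lt; rewrite divr_gt0.
    by apply: nbhs_pinfty_ge; rewrite num_real.
  near=> t el => tI z /= zlt.
  have xtt0 : `|x t0 - x t| < dl / 2 by exact: (near cxt t).
  have tt0 : `|t0 - t| < dl by exact: (near near_t0 t).
  have t_0 : 0 <= t by move: tI; rewrite /= in_itv /= => /andP[/(le_trans s0)].
  have [e2 l2] : el.1 < dl / 2 /\ l0 <= el.2 by exact: (near near_el el).
  apply: (@le_trans _ _ (l0 * `|z - x t|)); last exact: ler_wpM2r.
  apply: Hl => //; apply: dlV; split => //=.
    rewrite -ball_normE /= (_ : x t0 - z = (x t0 - x t) - (z - x t)); last first.
      by rewrite opprB addrA subrK.
    rewrite (le_lt_trans (ler_normB _ _))// (splitr dl) ltrD//.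
    exact: lt_trans zlt e2.
  rewrite -ball_normE /=; apply: lt_trans xtt0 _.
  by rewrite ltr_pdivrMr// ltr_pMr// ltr1n.
move=> [[A B] /= [A0 B0] AB].
near (0 : R)^'+ => e.
near (pinfty_nbhs R) => l.
exists e, l; split.
- by near: e; exact: nbhs_right_gt.
- by near: l; exact: nbhs_pinfty_gt.
- move=> t tI z; apply: (AB (e, l)) => //; split => /=; first by near: e.
  by near: l.
Unshelve. all: by end_near. Qed.

(** The sup norm is not differentiable; this squared Euclidean distance is, and
it is equivalent to the square of the sup norm. *)
Definition sqdist x y (t : R) : R := \sum_(i < d) (x t ord0 i - y t ord0 i) ^+ 2.

(** The function [expR (- m * t) * u t] has a nonpositive derivative. *)
Lemma gronwall (u : R -> R) (s b m : R) : s <= b ->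
  {within `[s, b], continuous u} ->
  (forall t, t \in `]s, b[ ->
    exists2 u' : R, is_derive t (1 : R) u u' & u' <= m * u t) ->
  u b <= expR (m * (b - s)) * u s.
Proof.
move=> sb cu du.
pose g t := expR (- m * t) * u t.
have dg t : t \in `]s, b[ -> exists2 g' : R, is_derive t (1 : R) g g' & g' <= 0.
  move=> /du[u' iu' u'm].
  exists (expR (- m * t) * u' + (expR (- m * t) * (- m)) * u t).
    have dm : is_derive t (1 : R) (fun t => - m * t) (- m).
      by apply: is_derive_eq; rewrite /GRing.scale /= mulr1 ?mul0r ?addr0.
    have de := is_derive1_comp (is_derive_expR (- m * t)) dm.
    apply: (is_derive_eq (is_deriveM de iu')).
    by rewrite /GRing.scale /= [u t * _]mulrC.
  rewrite -mulrA -mulrDr pmulr_rle0 ?expR_gt0// mulNr subr_le0//.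
have cg : {within `[s, b], continuous g}.
  move=> t; apply: (@continuousM _ (subspace `[s, b]) (fun t => expR (- m * t)) u).
    apply: continuous_subspaceT => z; apply: continuous_comp;
      last exact: continuous_expR.
    exact: mulrl_continuous.
  exact: cu.
have /(_ b s) : {in `[s, b] &, {homo g : x y /~ x <= y}}.
  apply: ler0_derive1_le_cc cg => t /dg[g' ig' g'0]; first exact: ex_derive.
  by rewrite derive1E derive_val.
rewrite !in_itv /= !lexx sb => /(_ isT isT isT); rewrite /g.
rewrite -(ler_pM2l (expR_gt0 (m * b))) !mulrA -!expRD mulNr subrr expR0 mul1r.
by rewrite mulNr -mulrBr.
Qed.

Lemma le_entry_norm (z : 'rV[R]_d) i : `|z ord0 i| <= `|z|.
Proof.
rewrite [leRHS]/Num.Def.normr /= mx_normrE.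
by apply: le_trans; last exact: (le_bigmax _ _ (ord0, i)).
Qed.

Lemma norm_sqr_le_sum (z : 'rV[R]_d) : `|z| ^+ 2 <= \sum_(i < d) z ord0 i ^+ 2.
Proof.
have [->|/mx_norm_neq0[[j i] /= zi]] := eqVneq `|z| 0.
  by rewrite expr0n; apply: sumr_ge0 => i _; exact: sqr_ge0.
rewrite {1}/Num.Def.normr /= zi (ord1 j) (bigD1 i)//= real_normK ?num_real// lerDl.
by apply: sumr_ge0 => k _; exact: sqr_ge0.
Qed.

Lemma sum_le_norm_sqr (z : 'rV[R]_d) :
  \sum_(i < d) z ord0 i ^+ 2 <= d%:R * `|z| ^+ 2.
Proof.
rewrite mulr_natl -[X in _ *+ X]card_ord -sumr_const ler_sum// => i _.
by rewrite -real_normK ?num_real// lerXn2r ?nnegrE// le_entry_norm.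
Qed.

Lemma sqdistE x y t : sqdist x y t = \sum_(i < d) (x t - y t) ord0 i ^+ 2.
Proof. by apply: eq_bigr => i _; rewrite !mxE. Qed.

Lemma sqdist_continuous x y (A : set R) :
  {within A, continuous x} -> {within A, continuous y} ->
  {within A, continuous (sqdist x y)}.
Proof.
move=> cx cy t.
rewrite (_ : sqdist x y = \sum_(i < d) (fun t => (x t ord0 i - y t ord0 i) ^+ 2));
  last first.
  by apply/funext => r; rewrite fct_sumE.
have cont (z : R -> 'rV[R]_d) i : {within A, continuous z} ->
    {within A, continuous (fun t => z t ord0 i)}.
  move=> cz r; apply: (@continuous_comp (subspace A) _ _ z (fun M => M ord0 i)).
    exact: cz.
  exact: coord_continuous.
elim/big_ind : _ => //.
- exact: cvg_cst.
- move=> f g; exact: cvgD.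
- move=> i _.
  have cB : {for t, continuous
      ((fun t => x t ord0 i - y t ord0 i) : subspace A -> R)}.
    by apply: cvgB; exact: cont.
  by exact: (@continuousM _ (subspace A) _ _ _ cB cB).
Qed.

Lemma is_derive_sqdist x y (x' y' : 'rV[R]_d) (t : R) :
  is_derive t (1 : R) x x' -> is_derive t (1 : R) y y' ->
  is_derive t (1 : R) (sqdist x y)
    (\sum_(i < d) 2 * (x t - y t) ord0 i * (x' - y') ord0 i).
Proof.
move=> dx dy.
have coord (z : R -> 'rV[R]_d) z' i : is_derive t (1 : R) z z' ->
    is_derive t (1 : R) (fun t => z t ord0 i) (z' ord0 i).
  move=> [dz <-]; apply: DeriveDef; first exact: (derivable_mxP _ _ _).1 dz ord0 i.
  by rewrite derive_mx// mxE.
rewrite (_ : sqdist x y = \sum_(i < d) (fun t => x t ord0 i - y t ord0 i) ^+ 2);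
  last first.
  by apply/funext => r; rewrite fct_sumE.
apply: is_derive_sum => i.
have dB := is_deriveB (coord _ _ i dx) (coord _ _ i dy).
apply: (is_derive_eq (is_deriveX 2 dB)).
by rewrite /GRing.scale /= !mxE expr1.
Qed.

(** The tube lemma only controls the field along the reference solution, so the
bound is propagated until the first time at which the two solutions are [e]
apart; the estimate itself shows that there is no such time.  The constant
[M = D + 1], with [D = d * expR (m * (T - s))], satisfies [D <= M ^ 2]. *)
Lemma solution_stability F (s T : R) x :
  locally_lipschitz_field F -> 0 <= s -> s <= T -> solution F s (x s) x ->
  exists eta M : R, [/\ 0 < eta, 0 < M & forall y, solution F s (y s) y ->
    `|y s - x s| < eta ->
    forall t, t \in `[s, T] -> `|y t - x t| <= M * `|y s - x s|].
Proof.
move=> Flip s0 sT [_ cx dx].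
have sub : `[s, T]%classic `<=` `[s, +oo[%classic.
  by move=> t /=; rewrite !in_itv /= => /andP[->].
have cxT := continuous_subspaceW sub cx.
have [e [l [e0 l0 tube]]] := lipschitz_tube Flip s0 cxT.
pose m := 2 * l * d%:R.
have m0 : 0 <= m by rewrite !mulr_ge0// ltW.
pose M := d%:R * expR (m * (T - s)) + 1.
have M1 : 1 <= M by rewrite lerDr mulr_ge0// expR_ge0.
have M0 : 0 < M by exact: lt_le_trans M1.
exists (e / M), M; split => //; first exact: divr_gt0.
move=> y [_ cy dy] ys.
have cyT := continuous_subspaceW sub cy.
have cu := sqdist_continuous cyT cxT.
set u := sqdist y x in cu.
have est b : b \in `[s, T] -> (forall t, t \in `]s, b[ -> u t < e ^+ 2) ->
    u b <= (M * `|y s - x s|) ^+ 2.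
  move=> bI ube; have /andP[sb bT] : s <= b <= T by rewrite in_itv in bI.
  have subb : `[s, b]%classic `<=` `[s, T]%classic.
    by move=> t /=; rewrite !in_itv /= => /andP[-> /le_trans->].
  apply: (@le_trans _ _ (expR (m * (b - s)) * u s)).
    apply: gronwall => //; first exact: continuous_subspaceW cu.
    move=> t tI; have /andP[st tb] : s < t < b by rewrite in_itv in tI.
    eexists; first by apply: is_derive_sqdist; [exact: dy|exact: dx].
    have yx : `|y t - x t| < e.
      rewrite -(ltr_pXn2r (n := 2))// ?nnegrE ?(ltW e0)//.
      apply: le_lt_trans (ube t tI); rewrite /u sqdistE; exact: norm_sqr_le_sum.
    apply: (@le_trans _ _ (\sum_(i < d) 2 * (l * `|y t - x t| ^+ 2))).
      apply: ler_sum => i _; rewrite -mulrA ler_wpM2l//.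
      apply: (le_trans (ler_norm _)); rewrite normrM expr2 mulrCA.
      apply: ler_pM => //; first exact: le_entry_norm.
      apply: le_trans (tube _ _ _ yx); first exact: le_entry_norm.
      by rewrite in_itv /= (ltW st) (le_trans (ltW tb)).
    rewrite sumr_const card_ord -mulr_natr.
    rewrite [leLHS](_ : _ = m * `|y t - x t| ^+ 2) ?ler_wpM2l//;
      last by rewrite /m; ring.
    by rewrite /u sqdistE; exact: norm_sqr_le_sum.
  apply: (@le_trans _ _ (expR (m * (T - s)) * (d%:R * `|y s - x s| ^+ 2))).
    apply: ler_pM; rewrite ?expR_ge0//.
    - by rewrite /u sqdistE; apply: sumr_ge0 => i _; exact: sqr_ge0.
    - by rewrite ler_expR ler_wpM2l// lerD2r.
    - rewrite /u sqdistE; exact: sum_le_norm_sqr.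
  rewrite mulrA [X in X * _]mulrC exprMn ler_wpM2r ?sqr_ge0//.
  rewrite expr2 (@le_trans _ _ M)// ?ler_peMr// 1?ltW// /M; lra.
have small : (M * `|y s - x s|) ^+ 2 < e ^+ 2.
  by rewrite ltr_pXn2r// ?nnegrE ?mulr_ge0// ?(ltW M0) ?(ltW e0)// mulrC -ltr_pdivlMr.
(* The first time at which the solutions are e apart would be inf S. *)
have bound b : b \in `[s, T] -> u b < e ^+ 2.
  move=> bI; rewrite ltNge; apply/negP => ub.
  pose S := [set t | t \in `[s, T] /\ e ^+ 2 <= u t].
  have infS : has_inf S.
    split; first by exists b.
    by exists s => t [+ _]; rewrite in_itv /= => /andP[].
  have sS : s <= inf S.
    apply: lb_le_inf; first by exists b.
    by move=> t [+ _]; rewrite in_itv /= => /andP[].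
  have ST : inf S <= T.
    apply: (@le_trans _ _ b); last by move: bI; rewrite in_itv /= => /andP[].
    by apply: ge_inf => //; case: infS.
  have SI : inf S \in `[s, T] by rewrite in_itv /= sS ST.
  have uS : u (inf S) < e ^+ 2.
    apply: le_lt_trans small; apply: est => // t tI.
    rewrite ltNge; apply/negP => ut.
    move: tI; rewrite in_itv /= => /andP[st] tS; move: (tS).
    rewrite ltNge => /negP; apply; apply: ge_inf; first by case: infS.
    by split => //; rewrite in_itv /= (ltW st) (le_trans (ltW tS)).
  have /subspace_continuousP/(_ _ SI)/cvgrPdist_lt := cu.
  move=> /(_ (e ^+ 2 - u (inf S))); rewrite subr_gt0 => /(_ uS).
  rewrite near_withinE => /nbhs_ballP[dl /= dl0 H].
  have [t St tlt] := inf_adherent dl0 infS.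
  have := H t; case: (St) => tI ut; rewrite -ball_normE /=.
  have it : inf S <= t by apply: ge_inf => //; case: infS.
  rewrite ler0_norm ?subr_le0// opprB ltrBlDl => /(_ tlt tI).
  rewrite ler0_norm ?subr_le0 ?(le_trans (ltW uS))// opprB ltrBlDr subrK.
  by rewrite ltNge ut.
move=> t tI; rewrite -(ler_pXn2r (n := 2))// ?nnegrE ?mulr_ge0 ?(ltW M0)//.
apply: (@le_trans _ _ (u t)); first by rewrite /u sqdistE norm_sqr_le_sum.
apply: est => // r rI; apply: bound.
move: rI tI; rewrite !in_itv /= => /andP[sr rt] /andP[_ tT].
by rewrite (ltW sr) (le_trans (ltW rt)).
Qed.

Lemma solution_unique F (s : R) (x0 : 'rV[R]_d) x y :
  locally_lipschitz_field F -> 0 <= s ->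
  solution F s x0 x -> solution F s x0 y -> forall t, s <= t -> x t = y t.
Proof.
move=> Flip s0 solx soly t st.
have [xs ys] : x s = x0 /\ y s = x0 by case: solx; case: soly.
have solxx : solution F s (x s) x by rewrite xs.
have [eta [M [eta0 _ H]]] := solution_stability Flip s0 st solxx.
have := H y; rewrite ys xs subrr normr0 mulr0 => /(_ soly eta0 t).
rewrite in_itv /= st lexx => /(_ isT).
by rewrite normr_le0 subr_eq0 => /eqP.
Qed.

Lemma solution_flow F (s : R) (x0 : 'rV[R]_d) : forward_complete F -> 0 <= s ->
  solution F s x0 (fun t => flow F t s x0).
Proof.
move=> Fc s0; have [x xP] := Fc s x0 s0.
exact: (xgetPex _ (ex_intro [set x | solution F s x0 x] x xP)).
Qed.

Lemma flow_comp F (s u t : R) (x0 : 'rV[R]_d) : locally_lipschitz_field F ->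
  forward_complete F -> 0 <= s -> s <= u -> u <= t ->
  flow F t u (flow F u s x0) = flow F t s x0.
Proof.
move=> Flip Fc s0 su ut; have u0 := le_trans s0 su.
apply: (solution_unique Flip u0 (solution_flow _ Fc u0)) => //.
have [_ cx dx] := solution_flow x0 Fc s0; split => //.
  apply: continuous_subspaceW cx => r /=.
  by rewrite !in_itv /= !andbT; exact: le_trans.
by move=> r ur; apply: dx; exact: le_lt_trans ur.
Qed.

Lemma flow_continuous F (s t : R) : locally_lipschitz_field F ->
  forward_complete F -> 0 <= s -> s <= t -> continuous (flow F t s).
Proof.
move=> Flip Fc s0 st x0; have solx := solution_flow x0 Fc s0.
have flow_id z : flow F s s z = z by case: (solution_flow z Fc s0).
have [eta [M [eta0 M0 H]]] : exists eta M : R, [/\ 0 < eta, 0 < M &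
    forall z, `|z - x0| < eta ->
      `|flow F t s z - flow F t s x0| <= M * `|z - x0|].
  have solxx : solution F s (flow F s s x0) (fun t => flow F t s x0).
    by rewrite flow_id.
  have [eta [M [eta0 M0 H]]] :=
    solution_stability (x := fun t => flow F t s x0) Flip s0 st solxx.
  exists eta, M; split => // z zeta.
  have solz : solution F s (flow F s s z) (fun t => flow F t s z).
    by rewrite flow_id; exact: solution_flow.
  have := H (fun t => flow F t s z) solz; rewrite !flow_id => /(_ zeta t).
  by rewrite in_itv /= st lexx => /(_ isT).
apply: (iffRL (@cvgrPdist_lt _ _ _ _ (nbhs_filter x0) _ _)) => e e0.
have r0 : 0 < Num.min eta (e / M) by rewrite lt_min eta0 divr_gt0.
apply: filterS (nbhsx_ballx x0 _ r0) => z; rewrite -ball_normE /= => zx.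
move: zx; rewrite lt_min distrC => /andP[zeta ze].
rewrite distrC (le_lt_trans (H _ zeta))//.
by rewrite mulrC -ltr_pdivlMr.
Qed.

Lemma continuous_measurable_rV (f : 'rV[R]_d -> 'rV[R]_d) :
  continuous f -> measurable_fun setT f.
Proof.
move=> cf; apply: (measurability (@open 'rV[R]_d)) => [|_ [B oB <-]]; first by [].
rewrite setTI; apply: sub_sigma_algebra.
exact: open_comp oB.
Qed.

End flow.

(** * Euclidean norm and Borel sets *)

Section euclidean_norm.
Context (R : realType) (d : nat).
Implicit Types x y z : 'rV[R]_d.

Lemma enorm_ge0 x : 0 <= enorm x. Proof. exact: sqrtr_ge0. Qed.

Lemma enormB x y : enorm (x - y) = enorm (y - x).
Proof.
rewrite /enorm; congr Num.sqrt; apply: eq_bigr => i _.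
by rewrite !mxE -sqrrN opprB.
Qed.

Lemma sqr_enorm x : enorm x ^+ 2 = \sum_(i < d) x ord0 i ^+ 2.
Proof. by rewrite sqr_sqrtr// sumr_ge0// => i _; exact: sqr_ge0. Qed.

Lemma cauchy_schwarz_enorm x y :
  \sum_(i < d) x ord0 i * y ord0 i <= enorm x * enorm y.
Proof.
have [x0|x0] := eqVneq (enorm x) 0.
  rewrite x0 mul0r big1// => i _.
  have /eqP : \sum_(i < d) x ord0 i ^+ 2 = 0 by rewrite -sqr_enorm x0 expr0n.
  rewrite psumr_eq0 => [/allP /(_ i)|j _]; last exact: sqr_ge0.
  by rewrite mem_index_enum sqrf_eq0 => /(_ isT) /eqP ->; rewrite mul0r.
have [y0|y0] := eqVneq (enorm y) 0.
  rewrite y0 mulr0 big1// => i _.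
  have /eqP : \sum_(i < d) y ord0 i ^+ 2 = 0 by rewrite -sqr_enorm y0 expr0n.
  rewrite psumr_eq0 => [/allP /(_ i)|j _]; last exact: sqr_ge0.
  by rewrite mem_index_enum sqrf_eq0 => /(_ isT) /eqP ->; rewrite mulr0.
have xy0 : 0 < enorm x * enorm y by rewrite mulr_gt0// lt0r ?x0 ?y0 enorm_ge0.
have : 0 <= \sum_(i < d) (enorm y * x ord0 i - enorm x * y ord0 i) ^+ 2.
  by apply: sumr_ge0 => i _; exact: sqr_ge0.
have -> : \sum_(i < d) (enorm y * x ord0 i - enorm x * y ord0 i) ^+ 2 =
    2 * (enorm x * enorm y) * (enorm x * enorm y - \sum_(i < d) x ord0 i * y ord0 i).
  have ex : enorm y ^+ 2 * enorm x ^+ 2 = \sum_(i < d) enorm y ^+ 2 * x ord0 i ^+ 2.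
    by rewrite (sqr_enorm x) mulr_sumr.
  have ey : enorm x ^+ 2 * enorm y ^+ 2 = \sum_(i < d) enorm x ^+ 2 * y ord0 i ^+ 2.
    by rewrite (sqr_enorm y) mulr_sumr.
  transitivity (enorm y ^+ 2 * enorm x ^+ 2 + enorm x ^+ 2 * enorm y ^+ 2
    - 2 * (enorm x * enorm y) * \sum_(i < d) x ord0 i * y ord0 i); last by ring.
  rewrite ex ey mulr_sumr -big_split -sumrB /=.
  by apply: eq_bigr => i _; ring.
by rewrite pmulr_rge0 ?subr_ge0// mulr_gt0.
Qed.

Lemma ler_enormD x y : enorm (x + y) <= enorm x + enorm y.
Proof.
rewrite -(ler_pXn2r (n := 2))// ?nnegrE ?addr_ge0 ?enorm_ge0//.
rewrite sqrrD !sqr_enorm.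
apply: (@le_trans _ _ (\sum_(i < d) x ord0 i ^+ 2 +
  (\sum_(i < d) x ord0 i * y ord0 i) *+ 2 + \sum_(i < d) y ord0 i ^+ 2)).
  rewrite -sumrMnl -!big_split /= ler_sum// => i _.
  by rewrite !mxE sqrrD.
by rewrite lerD2r lerD2l lerMn2r cauchy_schwarz_enorm.
Qed.

Lemma norm_le_enorm x : `|x| <= enorm x.
Proof.
rewrite -(ler_pXn2r (n := 2))// ?nnegrE ?enorm_ge0// sqr_enorm.
exact: norm_sqr_le_sum.
Qed.

Lemma enorm_le_norm x : enorm x <= Num.sqrt d%:R * `|x|.
Proof.
rewrite -(ler_pXn2r (n := 2))// ?nnegrE ?enorm_ge0 ?mulr_ge0 ?sqrtr_ge0//.
by rewrite exprMn sqr_enorm sqr_sqrtr// sum_le_norm_sqr.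
Qed.

End euclidean_norm.

Section borel.
Context (R : realType) (d : nat).

Lemma measurable_open (A : set 'rV[R]_d) : open A -> measurable A.
Proof. exact: sub_sigma_algebra. Qed.

Lemma measurable_closed (A : set 'rV[R]_d) : closed A -> measurable A.
Proof.
move=> cA; rewrite -(setCK A); apply: measurableC.
by apply: measurable_open; rewrite openC.
Qed.

Lemma measurable_point (x : 'rV[R]_d) : measurable [set x].
Proof.
apply: measurable_closed; apply: accessible_closed_set1.
exact/hausdorff_accessible/norm_hausdorff.
Qed.

Lemma measurable_coord (i : 'I_d) :
  measurable_fun setT (fun x : 'rV[R]_d => x ord0 i).
Proof.
apply: (measurability _ (RGenOpens.measurableE R)) => _ [_ [a [b ->] <-]].
rewrite setTI; apply: measurable_open; apply: open_comp; last exact: interval_open.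
by move=> x _; exact: coord_continuous.
Qed.

Lemma measurable_cost (p : R) :
  measurable_fun setT (fun z : 'rV[R]_d * 'rV[R]_d => enorm (z.1 - z.2) `^ p).
Proof.
apply: (measurableT_comp (measurable_powR p)).
apply: (measurableT_comp (continuous_measurable_fun (@sqrt_continuous R))).
under eq_fun do under eq_bigr do rewrite !mxE.
apply: measurable_sum => i; apply: measurable_funX; apply: measurable_funB.
- exact: (measurableT_comp (measurable_coord i) measurable_fst).
- exact: (measurableT_comp (measurable_coord i) measurable_snd).
Qed.

End borel.

(** * Moving the atoms of a uniform measure *)

(** Convexity of the power, with an equality for [th = b / (a + b)].  The right-hand
side is linear in [a `^ p] and [b `^ p], so it can be integrated before [th] is
chosen: this gives the inequality of Minkowski for an integral under one
measure and a sum. *)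
Lemma powR_split (R : realType) (p th a b : R) : 1 <= p -> 0 < th < 1 ->
  0 <= a -> 0 <= b ->
  (a + b) `^ p <= (1 - th) `^ (1 - p) * a `^ p + th `^ (1 - p) * b `^ p.
Proof.
move=> p1 /andP[th0 th1] a0 b0.
have th'0 : 0 < 1 - th by rewrite subr_gt0.
have scale (s c : R) : 0 < s -> 0 <= c -> s * (c / s) `^ p = s `^ (1 - p) * c `^ p.
  move=> s0 c0; rewrite powRM ?invr_ge0 ?(ltW s0)//.
  rewrite -powR_inv1 ?(ltW s0)// -powRrM mulN1r mulrCA mulrC; congr (_ * _).
  rewrite -{1}[s]powRr1 ?(ltW s0)// -powRD//.
  by apply/implyP => _; rewrite gt_eqF.
rewrite -!scale//.
have th01 : 0 <= 1 - th <= 1 by rewrite (ltW th'0) lerBlDr lerDl ltW.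
have : ((1 - th) * (a / (1 - th)) + (1 - (1 - th)) * (b / th)) `^ p <=
    (1 - th) * (a / (1 - th)) `^ p + (1 - (1 - th)) * (b / th) `^ p.
  apply: (convex_powR p1 (Itv01 (ltW th'0) (proj2 (andP th01))));
    by rewrite inE /= in_itv /= andbT divr_ge0// ltW.
rewrite opprB [1 + (th - 1)]addrC subrK.
by rewrite [_ * (a / _)]mulrCA [_ * (b / _)]mulrCA !divff ?gt_eqF// !mulr1.
Qed.

Section uniform_measure.
Context (R : realType) (d : nat).
Local Notation V := 'rV[R]_d.
Local Open Scope ereal_scope.

Definition uniform (N : nat) (x : nat -> V) (A : set V) : \bar R :=
  (N%:R^-1)%:E * \sum_(k < N) \d_(x k) A.

Lemma empiricalE (m n : nat) (x : nat -> V) : (m <= n)%N ->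
  empirical m n x = uniform (n - m + 1) (fun k => x (k + m)%N).
Proof.
move=> mn; apply/funext => A; rewrite /empirical /uniform; congr (_ * _).
by rewrite -{1}[m]add0n big_addn subSn// addn1 big_mkord.
Qed.

Lemma uniformE N x (A : set V) :
  uniform N x A = (N%:R^-1 * \sum_(k < N) \1_A (x k))%:E.
Proof. by rewrite /uniform EFinM -sumEFin. Qed.

End uniform_measure.

Lemma ge0_integral_mrestr d (T : measurableType d) (R : realType)
    (mu : {measure set T -> \bar R}) (D : set T) (mD : measurable D)
    (f : T -> \bar R) : measurable_fun setT f -> (forall x, 0 <= f x)%E ->
  (\int[mrestr mu mD]_x f x = \int[mu]_(x in D) f x)%E.
Proof.
move=> mf f0.
have D0 : mrestr mu mD (~` D) = 0%E by rewrite /mrestr setICl measure0.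
rewrite (ge0_negligible_integral (measurableC mD) measurableT mf _ D0)//.
rewrite setDE setCK setTI; apply: eq_measure_integral => A mA AD.
by rewrite /= /mrestr (setIidl AD).
Qed.

Section reroute.
Context (R : realType) (d : nat).
Local Notation V := 'rV[R]_d.
Context (N : nat) (x y : nat -> V) (mu : set V -> \bar R).
Context (pi : probability (V * V)%type R).
Local Open Scope ereal_scope.

(** The points [x k] need not be distinct, so [cell k] is counted with weight
[1 / multiplicity k]. *)
Definition multiplicity (k : nat) : nat := (\sum_(j < N) (x j == x k))%N.

Definition cell (k : nat) : set (V * V) := [set x k] `*` setT.

Lemma measurable_cell k : measurable (cell k).
Proof. by apply: measurableX => //; exact: measurable_point. Qed.

Definition move_to (k : nat) (z : V * V) : V * V := (y k, z.2).

Lemma measurable_move_to k : measurable_fun setT (move_to k).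
Proof. by apply: measurable_fun_pair => //; exact: measurable_snd. Qed.

Lemma inv_multiplicity_ge0 k : (0 <= (multiplicity k)%:R^-1 :> R)%R.
Proof. by rewrite invr_ge0. Qed.

(** The measure structure of a push-forward depends on a proof that the map is
measurable; it is not found by inference and is given by name. *)
Definition moved_cell (k : nat) : {measure set (V * V) -> \bar R} :=
  mscale (NngNum (inv_multiplicity_ge0 k))
    (measure_function_pushforward__canonical__measure_function_Measure
      (mrestr pi (measurable_cell k)) (measurable_move_to k)).

(** The image of [pi] under the random map that sends [(v, z)] to [(y k, z)],
where [k] is uniform among the indices with [x k = v]. *)
Definition reroute : set (V * V) -> \bar R := msum moved_cell N.

Hypothesis pi_coupling : coupling (uniform N x) mu pi.

Lemma multiplicity_gt0 k : (k < N)%N -> (0 < multiplicity k)%N.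
Proof.
by move=> kN; rewrite /multiplicity (bigD1 (Ordinal kN))//= eqxx.
Qed.

Lemma mass_cell k : pi (cell k) = ((multiplicity k)%:R / N%:R)%:E.
Proof.
have [-> _] := pi_coupling (measurable_point (x k)).
rewrite uniformE mulrC /multiplicity natr_sum; congr ((_ * _)%R%:E).
apply: eq_bigr => j _; rewrite indicE; congr (nat_of_bool _)%:R.
by apply/idP/idP; rewrite inE => /eqP.
Qed.

Lemma integral_moved_cell k (f : V * V -> \bar R) :
  measurable_fun setT f -> (forall z, 0 <= f z) ->
  \int[moved_cell k]_z f z =
  (multiplicity k)%:R^-1%:E * \int[pi]_(z in cell k) f (move_to k z).
Proof.
move=> mf f0.
have mfk : measurable_fun setT (f \o move_to k).
  exact: measurableT_comp mf (measurable_move_to k).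
rewrite ge0_integral_mscale//=.
rewrite (ge0_integral_pushforward (measurable_move_to k) _ measurableT mf); last first.
  by move=> ? _; exact: f0.
by rewrite preimage_setT ge0_integral_mrestr// => z; exact: f0.
Qed.

(** The weights of the cells that contain a given point add up to one, and almost
every point is in some cell. *)
Lemma sum_cells (g : V * V -> \bar R) :
  measurable_fun setT g -> (forall z, 0 <= g z) ->
  \sum_(k < N) (multiplicity k)%:R^-1%:E * \int[pi]_(z in cell k) g z =
  \int[pi]_z g z.
Proof.
move=> mg g0.
have mgk k : measurable_fun setT (g \_ (cell k)).
  apply/(measurable_restrictT _ (measurable_cell k)).
  exact: measurable_funS mg.
have gk0 k z : 0 <= (g \_ (cell k)) z by rewrite patchE; case: ifP.
have mgZ (k : 'I_N) : measurable_fun setT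
    (fun z => (multiplicity k)%:R^-1%:E * (g \_ (cell k)) z).
  exact: measurable_funeM.
have gZ0 (k : 'I_N) z : 0 <= (multiplicity k)%:R^-1%:E * (g \_ (cell k)) z.
  by rewrite mule_ge0// lee_fin invr_ge0.
transitivity (\int[pi]_z (\sum_(k < N)
    (multiplicity k)%:R^-1%:E * (g \_ (cell k)) z)).
  rewrite (ge0_integral_sum _ _ mgZ)//.
  apply: eq_bigr => k _; rewrite [in LHS]integral_mkcond [RHS]ge0_integralZl//.
(* B has no mass for the first marginal. *)
pose B := [set v : V | forall k, (k < N)%N -> v <> x k].
have mB : measurable B.
  rewrite (_ : B = ~` \bigcup_(k in [set k | (k < N)%N]) [set x k]); last first.
    apply/seteqP; split=> [v Bv [k /= kN]|v Bv k kN vk]; first exact: Bv.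
    by apply: Bv; exists k.
  apply/measurableC/bigcup_measurable => k _; exact: measurable_point.
have B0 : pi (B `*` setT) = 0.
  have [-> _] := pi_coupling mB.
  rewrite uniformE big1 ?mulr0// => k _; rewrite indicE memNset//.
  by move=> /(_ k (ltn_ord k)).
apply: ge0_ae_eq_integral => //.
- by apply: emeasurable_sum => k; exact: mgZ.
- by move=> z _; apply: sume_ge0 => k _.
- exists (B `*` setT); split => //; first exact: measurableX.
  move=> z /= /not_implyP[_ neq]; split => // k kN zk; apply: neq.
  transitivity (\sum_(j < N) ((multiplicity k)%:R^-1 * (x j == x k)%:R)%:E * g z).
    apply: eq_bigr => j _; rewrite patchE.
    have -> : (z \in cell j) = (x j == x k).
      rewrite -zk; apply/idP/eqP => [/set_mem[]//|xz].
      by apply/mem_set; split.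
    have [jk|] := eqVneq; last by rewrite mulr0 mule0 mul0e.
    by rewrite mulr1 /multiplicity jk.
  rewrite -ge0_sume_distrl; last by move=> j _; rewrite lee_fin mulr_ge0// invr_ge0.
  rewrite sumEFin -mulr_sumr -natr_sum mulVf ?mul1e// pnatr_eq0 -lt0n.
  exact: multiplicity_gt0.
Qed.

Lemma rerouteE A :
  reroute A = \sum_(k < N)
    (multiplicity k)%:R^-1%:E * pi (cell k `&` move_to k @^-1` A).
Proof. by apply: eq_bigr => k _; rewrite setIC. Qed.

Lemma reroute_snd A : measurable A -> reroute (setT `*` A) = mu A.
Proof.
move=> mA; have mTA : measurable (setT `*` A : set (V * V)) by exact: measurableX.
have [_ <-] := pi_coupling mA.
have <- : \int[pi]_z (\1_(setT `*` A) z)%:E = pi (setT `*` A).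
  by rewrite integral_indic// setIT.
rewrite -sum_cells//; last first.
  by apply/measurable_EFinP; exact: measurable_indic.
rewrite rerouteE; apply: eq_bigr => k _.
by rewrite integral_indic//; [rewrite setIC|exact: measurable_cell].
Qed.

Lemma scaled_mass_cell k : (k < N)%N ->
  (multiplicity k)%:R^-1%:E * pi (cell k) = (N%:R^-1)%:E.
Proof.
move=> kN; rewrite mass_cell -EFinM mulrA mulVf ?mul1r//.
by rewrite pnatr_eq0 -lt0n multiplicity_gt0.
Qed.

Lemma reroute_fst A : reroute (A `*` setT) = uniform N y A.
Proof.
rewrite rerouteE uniformE mulr_sumr -sumEFin; apply: eq_bigr => k _.
rewrite indicE; have [yA|yA] := boolP (y k \in A).
  rewrite (_ : _ `&` _ = cell k) ?scaled_mass_cell ?mulr1//.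
  by apply: setIidl => z _; split => //; exact: set_mem.
rewrite (_ : _ `&` _ = set0) ?measure0 ?mule0 ?mulr0//.
rewrite -subset0 => z [_ [/= + _]].
by rewrite notin_setE in yA.
Qed.

Lemma rerouteT : reroute setT = 1.
Proof.
have [_ muT] := pi_coupling measurableT.
by rewrite -setXTT reroute_snd// -muT setXTT probability_setT.
Qed.

HB.instance Definition _ := Measure.copy reroute (msum moved_cell N).

HB.instance Definition _ := Measure_isProbability.Build _ _ _ reroute rerouteT.

Definition rerouted : probability (V * V)%type R := reroute.

Lemma reroute_coupling : coupling (uniform N y) mu rerouted.
Proof. by move=> A mA; split; [exact: reroute_fst|exact: reroute_snd]. Qed.

(** On the cell of [x k], the triangle inequality bounds the distance from [y k]
to the target by the displacement [enorm (x k - y k)] plus the old distance. *)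
Lemma reroute_cost (p th : R) : (1 <= p)%R -> (0 < th < 1)%R ->
  \int[rerouted]_z (enorm (z.1 - z.2) `^ p)%:E <=
  ((1 - th) `^ (1 - p))%:E * \int[pi]_z (enorm (z.1 - z.2) `^ p)%:E +
  (th `^ (1 - p) * (N%:R^-1 * \sum_(k < N) enorm (x k - y k) `^ p))%:E.
Proof.
move=> p1 th01; set a := (_ `^ (1 - p))%R; set b := (th `^ (1 - p))%R.
have a0 : (0 <= a)%R by exact: powR_ge0.
have b0 : (0 <= b)%R by exact: powR_ge0.
pose c (z : V * V) : \bar R := (enorm (z.1 - z.2) `^ p)%:E.
have mc : measurable_fun setT c by apply/measurable_EFinP; exact: measurable_cost.
have c0 z : 0 <= c z by rewrite lee_fin powR_ge0.
have step (k : 'I_N) : \int[pi]_(z in cell k) c (move_to k z) <=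
    a%:E * \int[pi]_(z in cell k) c z +
    (b * enorm (x k - y k) `^ p)%:E * pi (cell k).
  have mcell := measurable_cell k.
  have mck : measurable_fun (cell k) c by exact: measurable_funS mc.
  rewrite -integral_cst// -ge0_integralZl_EFin// -ge0_integralD//; last 3 first.
  - by move=> z _; rewrite mule_ge0.
  - exact: measurable_funeM.
  - by move=> z _; rewrite lee_fin mulr_ge0 ?powR_ge0.
  apply: ge0_le_integral.
  - exact: mcell.
  - by move=> z _; exact: c0.
  - exact: measurable_funS (measurableT_comp mc (measurable_move_to k)).
  - by apply: emeasurable_funD; [exact: measurable_funeM|exact: measurable_cst].
  move=> z [/= zk _]; rewrite /c /move_to /= -EFinM -EFinD lee_fin -zk.
  apply: le_trans (powR_split p1 th01 (enorm_ge0 _) (enorm_ge0 _)).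
  apply: ge0_ler_powR; rewrite ?nnegrE ?addr_ge0 ?enorm_ge0 ?(le_trans _ p1)//.
  rewrite (enormB z.1 (y k)) [leRHS]addrC.
  by apply: le_trans (ler_enormD _ _); rewrite subrKA.
rewrite [leLHS](ge0_integral_measure_sum moved_cell measurableT (fun z _ => c0 z) mc N).
rewrite -(sum_cells mc c0) ge0_sume_distrr; last first.
  by move=> k _; rewrite mule_ge0 ?integral_ge0// lee_fin invr_ge0.
rewrite mulrA mulr_sumr -sumEFin -big_split /=; apply: lee_sum => k _.
rewrite integral_moved_cell//.
apply: (@le_trans _ _ ((multiplicity k)%:R^-1%:E *
  (a%:E * \int[pi]_(z in cell k) c z +
   (b * enorm (x k - y k) `^ p)%:E * pi (cell k)))).
  by apply: lee_pmul => //; rewrite ?lee_fin ?invr_ge0// integral_ge0.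
rewrite ge0_muleDr ?mule_ge0 ?integral_ge0 ?lee_fin ?mulr_ge0 ?powR_ge0//.
by rewrite muleCA leeD2l// muleCA scaled_mass_cell// -EFinM lee_fin mulrAC.
Qed.

End reroute.

Section wasserstein.
Context (R : realType) (d : nat).
Local Notation V := 'rV[R]_d.
Implicit Types (p a b : R) (mu nu : set V -> \bar R) (x y : nat -> V).
Local Open Scope ereal_scope.

Definition transport_cost p mu nu : \bar R :=
  ereal_inf [set \int[pi]_z (enorm (z.1 - z.2) `^ p)%:E
            | pi in @coupling R d mu nu].

Lemma transport_cost_ge0 p mu nu : 0 <= transport_cost p mu nu.
Proof.
apply: le_ereal_inf_tmp => _ [pi _ <-].
by apply: integral_ge0 => z _; rewrite lee_fin powR_ge0.
Qed.

Lemma wassersteinE p mu nu :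
  wasserstein p mu nu = transport_cost p mu nu `^ p^-1.
Proof. by []. Qed.

Lemma wasserstein_ge0 p mu nu : 0 <= wasserstein p mu nu.
Proof. exact: poweR_ge0. Qed.

Lemma wasserstein_powR p mu nu : (1 <= p)%R ->
  wasserstein p mu nu `^ p = transport_cost p mu nu.
Proof.
move=> p1; rewrite wassersteinE -poweRrM mulVf ?gt_eqF ?(lt_le_trans _ p1)//.
by rewrite poweRe1// transport_cost_ge0.
Qed.

Lemma wasserstein_le p a mu nu : (1 <= p)%R -> (0 <= a)%R ->
  (wasserstein p mu nu <= a%:E) = (transport_cost p mu nu <= (a `^ p)%:E).
Proof.
move=> p1 a0; have p0 : (0 < p)%R by exact: lt_le_trans p1.
have T0 := transport_cost_ge0 p mu nu.
apply/idP/idP => [Wa|Ta].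
  rewrite -wasserstein_powR// -poweR_EFin; apply: gt0_ler_poweR => //.
  - exact: ltW.
  - by rewrite in_itv /= wasserstein_ge0 leey.
  - by rewrite in_itv /= lee_fin a0 leey.
rewrite wassersteinE (_ : a = (a `^ p) `^ p^-1)%R; last first.
  by rewrite -powRrM divff ?powRr1// gt_eqF.
rewrite -poweR_EFin; apply: gt0_ler_poweR => //.
- by rewrite invr_ge0 ltW.
- by rewrite in_itv /= T0 leey.
- by rewrite in_itv /= lee_fin powR_ge0 leey.
Qed.

(** Both bounds are enlarged by [e / 2] to make them positive and to have a
coupling of cost below the first one; the choice of [th] turns [reroute_cost]
into the triangle inequality. *)
Lemma wasserstein_move p (a b : R) N mu x y :
  (1 <= p)%R -> (0 <= a)%R -> (0 <= b)%R ->
  wasserstein p (uniform N x) mu <= a%:E ->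
  (N%:R^-1 * \sum_(k < N) enorm (x k - y k) `^ p <= b `^ p)%R ->
  wasserstein p (uniform N y) mu <= (a + b)%:E.
Proof.
move=> p1 a0 b0 Wa Sb; have p0 : (0 < p)%R by exact: lt_le_trans p1.
apply/lee_addgt0Pr => e e0.
pose a' := (a + e / 2)%R; pose b' := (b + e / 2)%R.
have e20 : (0 < e / 2)%R by rewrite divr_gt0.
have a'0 : (0 < a')%R by rewrite ltr_wpDl.
have b'0 : (0 < b')%R by rewrite ltr_wpDl.
have s0 : (0 < a' + b')%R by rewrite addr_gt0.
have -> : (a + b)%:E + e%:E = (a' + b')%:E.
  by rewrite -EFinD /a' /b'; congr EFin; lra.
rewrite wasserstein_le ?(ltW s0)//.
have : transport_cost p (uniform N x) mu < (a' `^ p)%:E.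
  move: Wa; rewrite wasserstein_le// => /le_lt_trans; apply.
  by rewrite lte_fin gt0_ltr_powR ?nnegrE ?(ltW a'0)// ltrDl.
move=> /ereal_inf_lt[_ [pi cpi <-] pia].
pose th := (b' / (a' + b'))%R.
have th01 : (0 < th < 1)%R.
  by rewrite divr_gt0//= ltr_pdivrMr// mul1r ltrDr.
apply: (@le_trans _ _ (\int[rerouted y cpi]_z (enorm (z.1 - z.2) `^ p)%:E)).
  apply: ereal_inf_lbound; exists (rerouted y cpi) => //.
  exact: reroute_coupling.
apply: (le_trans (reroute_cost y cpi p1 th01)).
have -> : ((a' + b') `^ p =
    (1 - th) `^ (1 - p) * a' `^ p + th `^ (1 - p) * b' `^ p)%R.
  have scale s : (0 < s)%R ->
      ((s / (a' + b')) `^ (1 - p) * s `^ p = s * (a' + b') `^ (p - 1))%R.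
    move=> s'0; rewrite powRM ?invr_ge0 ?(ltW s'0) ?(ltW s0)// -powR_inv1 ?(ltW s0)//.
    rewrite -powRrM mulN1r opprB mulrAC; congr (_ * _)%R.
    by rewrite -powRD ?subrK ?powRr1 ?(ltW s'0)// gt_eqF// implybT.
  have -> : (1 - th = a' / (a' + b'))%R.
    by rewrite /th -{1}(divff (lt0r_neq0 s0)) -mulrBl addrK.
  rewrite !scale// -mulrDl -{2}[(a' + b')%R]powRr1 ?(ltW s0)// -powRD ?subrKC//.
  by rewrite gt_eqF// implybT.
rewrite EFinD; apply: leeD.
  by rewrite EFinM lee_wpmul2l ?lee_fin ?powR_ge0// ltW.
rewrite lee_fin ler_wpM2l ?powR_ge0// (le_trans Sb)//.
by rewrite ge0_ler_powR ?nnegrE ?(ltW p0) ?(ltW b'0)// lerDl ltW.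
Qed.

End wasserstein.

(** * Separability: supports and the deviation event *)

Section separability.
Context (R : realType) (d : nat).
Local Notation V := 'rV[R]_d.

Definition rational_point (q : 'rV[rat]_d) : V := map_mx ratr q.

Lemma rational_point_dense (x : V) (e : R) : 0 < e ->
  exists q, enorm (x - rational_point q) < e.
Proof.
move=> e0; pose r := e / (Num.sqrt d%:R + 1).
have s0 : 0 < Num.sqrt d%:R + 1 :> R by rewrite ltr_wpDl ?sqrtr_ge0.
have r0 : 0 < r by rewrite divr_gt0.
have approx i : exists q : rat, `|x ord0 i - ratr q| < r.
  have /rat_in_itvoo[q] : x ord0 i - r < x ord0 i + r by rewrite ltrD2l gtrN.
  by rewrite in_itv /= => qr; exists q; rewrite ltr_distlC.
have [q qP] := choice approx.
exists (\row_i q i); apply: le_lt_trans (enorm_le_norm _) _.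
apply: (@le_lt_trans _ _ (Num.sqrt d%:R * r)).
  rewrite ler_wpM2l ?sqrtr_ge0// [leLHS]/Num.Def.normr /= mx_normrE.
  by apply: bigmax_le => [|[j i] _]; rewrite ?ltW//= !mxE (ord1 j).
by rewrite /r mulrCA gtr_pMr// ltr_pdivrMr// mul1r ltrDl.
Qed.

Lemma open_enorm_ball (x : V) (r : R) : open [set y | enorm (x - y) < r].
Proof.
rewrite openE => y /= yr; rewrite /interior /=.
have s0 : 0 < Num.sqrt d%:R + 1 :> R by rewrite ltr_wpDl ?sqrtr_ge0.
have e0 : 0 < (r - enorm (x - y)) / (Num.sqrt d%:R + 1) by rewrite divr_gt0// subr_gt0.
apply: filterS (nbhsx_ballx y _ e0) => z; rewrite -ball_normE /= => yz.
rewrite -(subrKA y) (le_lt_trans (ler_enormD _ _))// -ltrBrDl.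
apply: le_lt_trans (enorm_le_norm _) _.
have [yz0|yz0] := leP `|y - z| 0; last first.
  move: yz; rewrite ltr_pdivlMr// mulrC; apply: le_lt_trans.
  by rewrite ler_wpM2r// lerDl.
apply: (@le_lt_trans _ _ 0); last by rewrite subr_gt0.
by rewrite mulr_ge0_le0 ?sqrtr_ge0.
Qed.

Lemma supp_closed (mu : set V -> \bar R) : closed (supp mu).
Proof.
rewrite -openC openE => x /= /existsNP[U /not_implyP[oU /not_implyP[Ux muU]]].
apply: filterS (open_nbhs_nbhs (conj oU Ux)) => y Uy /= /(_ U oU Uy).
exact: muU.
Qed.

(** A point outside the support has a null neighbourhood, hence a null ball with
rational centre and radius; there are countably many of these. *)
Lemma supp_full (mu : {measure set V -> \bar R}) : mu (~` supp mu) = 0%E.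
Proof.
pose B (i : 'rV[rat]_d * rat) : set V :=
  [set y | enorm (rational_point i.1 - y) < ratr i.2].
have mB i : measurable (B i) by apply: measurable_open; exact: open_enorm_ball.
pose B0 i := if mu (B i) == 0%E then B i else set0.
have mB0 i : measurable (B0 i) by rewrite /B0; case: ifP.
have sub : ~` supp mu `<=` \bigcup_i B0 i.
  move=> x /= /existsNP[U /not_implyP[oU /not_implyP[Ux muU]]].
  have [r r0 rU] : exists2 r : R, 0 < r & [set y | enorm (x - y) < r] `<=` U.
    have /nbhs_ballP[r /= r0 rU] : nbhs x U by exact: open_nbhs_nbhs.
    exists r => // y /= xy; apply: rU; rewrite -ball_normE /=.
    exact: le_lt_trans (norm_le_enorm _) xy.
  have /rat_in_itvoo[s] : 0 < r / 2 by rewrite divr_gt0.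
  rewrite in_itv /= => /andP[s0 sr].
  have [q qs] := rational_point_dense x s0.
  exists (q, s) => //; rewrite /B0.
  have BU : B (q, s) `<=` U.
    move=> y; rewrite /B /= => qy; apply: rU => /=.
    rewrite -(subrKA (rational_point q)) (le_lt_trans (ler_enormD _ _))//.
    by rewrite (splitr r) ltrD// (lt_trans _ sr).
  rewrite ifT; first by rewrite /B /= enormB.
  rewrite eq_le measure_ge0 andbT.
  apply: (@le_trans _ _ (mu U)).
    by apply: le_measure; rewrite ?inE//; exact: measurable_open.
  by rewrite leNgt; apply/negP.
have mS : measurable (~` supp mu).
  by apply: measurableC; apply: measurable_closed; exact: supp_closed.
pose F n := if @unpickle ('rV[rat]_d * rat)%type n is Some i then B0 i else set0.
have mF n : measurable (F n) by rewrite /F; case: unpickle.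
have subF : ~` supp mu `<=` \bigcup_n F n.
  move=> x /sub[i _ Bx]; exists (pickle i) => //.
  by rewrite /F pickleK.
apply: (measure_negligible mS); apply: negligibleS subF _.
apply: negligible_bigcup => n; exists (F n); split => //.
rewrite /F; case: unpickle => [i|]; last by rewrite measure0.
by rewrite /B0; case: ifP => [/eqP//|]; rewrite measure0.
Qed.

(** The event is a countable union over rational configurations [q] and radii
[r] with [W q + r < e]: the sample is within [r] of [q].  By [wasserstein_move]
each of these events implies [W < e], and density gives equality. *)
Lemma measurable_wasserstein_lt disp (Omega : measurableType disp)
    (X : nat -> {mfun Omega >-> V}) (p e : R) N (mu : set V -> \bar R) : 1 <= p ->
  measurable [set w | (wasserstein p (uniform N (fun k => X k w)) mu < e%:E)%E].
Proof.
move=> p1; pose W x := wasserstein p (uniform N x) mu.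
have p0 : 0 < p by exact: lt_le_trans p1.
have close (r : R) x y : 0 <= r -> (forall k, (k < N)%N -> enorm (x k - y k) < r) ->
    forall a : R, 0 <= a -> (W x <= a%:E)%E -> (W y <= (a + r)%:E)%E.
  move=> r0 xy a a0; move=> Wa; apply: wasserstein_move Wa _ => //.
  apply: (@le_trans _ _ (N%:R^-1 * \sum_(k < N) r `^ p)).
    rewrite ler_wpM2l ?invr_ge0//; apply: ler_sum => k _.
    by rewrite ge0_ler_powR ?nnegrE ?enorm_ge0 ?(ltW p0)// ltW// xy.
  rewrite sumr_const card_ord -[_ `^ _ *+ _]mulr_natl mulrA.
  rewrite ler_piMl ?powR_ge0//.
  by have [->|N0] := eqVneq N 0%N; rewrite ?mulr0// mulVf ?pnatr_eq0.
pose Q := ({ffun 'I_N -> 'rV[rat]_d} * rat)%type.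
pose pt (i : Q) (k : nat) : V :=
  if insub k is Some k' then rational_point (i.1 k') else 0.
pose E (i : Q) := if (W (pt i) + (ratr i.2)%:E < e%:E)%E && (0 < i.2) then
  \bigcap_(k in [set k | (k < N)%N])
    (X k @^-1` [set v | enorm (pt i k - v) < ratr i.2])
  else set0.
have -> : [set w | (W (X ^~ w) < e%:E)%E] = \bigcup_i E i.
  apply/seteqP; split => [w /= Ww|w [[q r] _]]; last first.
    rewrite /E /=; case: ifP => // /andP[Wr r0] wE.
    have r0' : 0 <= ratr r :> R by rewrite ler0q ltW.
    have Wfin : W (pt (q, r)) \is a fin_num.
      rewrite ge0_fin_numE ?wasserstein_ge0//.
      by rewrite ltNge leye_eq; apply/negP => /eqP WE; move: Wr; rewrite WE.
    apply: le_lt_trans Wr; rewrite -(fineK Wfin) -EFinD.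
    apply: close wE _ _ _ => //; first exact/fine_ge0/wasserstein_ge0.
    by rewrite fineK.
  have Wfin : W (X ^~ w) \is a fin_num.
    by rewrite ge0_fin_numE ?wasserstein_ge0// (lt_trans Ww) ?ltry.
  move: Ww; rewrite -(fineK Wfin) lte_fin => We.
  have W0 : 0 <= fine (W (X ^~ w)) by exact/fine_ge0/wasserstein_ge0.
  have /rat_in_itvoo[r] : 0 < (e - fine (W (X ^~ w))) / 2 by rewrite divr_gt0// subr_gt0.
  rewrite in_itv /= => /andP[r0 re].
  have [q qP] := choice (fun k : 'I_N => rational_point_dense (X k w) r0).
  have ptE (k : 'I_N) : pt ([ffun k => q k], r) k = rational_point (q k).
    by rewrite /pt valK ffunE.
  exists ([ffun k => q k], r) => //; rewrite /E /=.
  have r0' : 0 < r by rewrite -(ltr0q R).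
  rewrite r0' andbT ifT.
    by move=> k /= kN; rewrite (ptE (Ordinal kN)) enormB;
      exact: (qP (Ordinal kN)).
  apply: (@le_lt_trans _ _ ((fine (W (X ^~ w)) + ratr r)%:E + (ratr r)%:E)%E).
    rewrite leeD2r//; apply: (close (ratr r) (X ^~ w) _ (ltW r0) _ _ W0).
      by move=> k kN; rewrite (ptE (Ordinal kN)); exact: (qP (Ordinal kN)).
    by rewrite fineK.
  rewrite -EFinD lte_fin; lra.
apply: countable_bigcupT_measurable => [|i]; first exact: countableP.
rewrite /E; case: ifP => // _.
rewrite (_ : \bigcap_(k in _) _ = ~` \bigcup_(k in [set k | (k < N)%N])
    (X k @^-1` ~` [set v | enorm (pt i k - v) < ratr i.2])); last first.
  by rewrite setC_bigcup; apply: eq_bigcapr => k _; rewrite preimage_setC setCK.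
apply/measurableC/bigcup_measurable => k _.
rewrite -[X in measurable X]setTI; apply: measurable_funP => //.
by apply: measurableC; apply: measurable_open; exact: open_enorm_ball.
Qed.

End separability.

(** * The radius *)

Section radius.
Context (R : realType).
Implicit Types (p C c beta rho : R).

(** Since [ln 2 <= ln (2 + 1 / x)], with [ln (2 + 1 / x) <= ln 3] for [1 <= x],
the value [y] lies between those at [sqrt y * ln 2] and at any point above both
[1] and [sqrt y * ln 3]. *)
Lemma hfun_surj (y : R) : 0 < y -> exists2 x, 0 < x & hfun x = y.
Proof.
move=> y0.
have ln_gt0 (x : R) : 0 < x -> 0 < ln (2 + 1 / x).
  by move=> x0; rewrite ln_gt0// ltr_pwDr ?ler1n// divr_gt0.
have l2 : 0 < ln 2 :> R by rewrite exp.ln_gt0// ltr1n.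
have l3 : 0 < ln 3 :> R by rewrite exp.ln_gt0// ltr1n.
pose s := Num.sqrt y; have s0 : 0 < s by rewrite sqrtr_gt0.
have ys : y = s ^+ 2 by rewrite sqr_sqrtr// ltW.
pose a := s * ln 2; pose b := Num.max 1 (s * ln 3) + a.
have a0 : 0 < a by rewrite mulr_gt0.
have b1 : 1 <= b by rewrite ler_wpDr ?(ltW a0)// le_max lexx.
have ab : a <= b by rewrite lerDr le_max ler01.
have ha : hfun a <= y.
  rewrite /hfun ys -expr_div_n lerXn2r ?nnegrE ?divr_ge0 ?(ltW s0) ?(ltW a0)
    ?(ltW (ln_gt0 _ a0))//.
  rewrite ler_pdivrMr ?ln_gt0// ler_pM2l// ler_ln ?posrE ?addr_gt0 ?divr_gt0//.
  by rewrite lerDl divr_ge0// ltW.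
have b0 : 0 < b by exact: lt_le_trans b1.
have hb : y <= hfun b.
  rewrite /hfun ys -expr_div_n lerXn2r ?nnegrE ?divr_ge0 ?(ltW s0) ?(ltW b0)
    ?(ltW (ln_gt0 _ b0))//.
  rewrite ler_pdivlMr ?ln_gt0//; apply: (@le_trans _ _ (s * ln 3)).
    rewrite ler_pM2l// ler_ln ?posrE ?addr_gt0 ?divr_gt0//.
    have : 1 / b <= 1 by rewrite ler_pdivrMr// mul1r.
    lra.
  by rewrite ler_wpDr ?(ltW a0)// le_max lexx orbT.
have ch : {within `[a, b], continuous (@hfun R)}.
  apply: continuous_in_subspaceT => x; rewrite inE /= in_itv /= => /andP[ax _].
  have x0 : 0 < x by exact: lt_le_trans ax.
  have cl : {for x, continuous (fun x : R => ln (2 + 1 / x))}.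
    apply: (@continuous_comp _ _ _ (fun x : R => 2 + 1 / x) (@ln R)).
      apply: cvgD; first exact: cvg_cst.
      apply: cvgM; first exact: cvg_cst.
      by apply: cvgV; [rewrite gt_eqF|exact: cvg_id].
    by apply: continuous_ln; rewrite addr_gt0// divr_gt0.
  apply: cvgM; first exact: exprn_continuous.
  apply: cvgV; first by rewrite expf_eq0 /= gt_eqF ?ln_gt0.
  apply: (@continuous_comp _ _ _ (fun x : R => ln (2 + 1 / x)) (fun z => z ^+ 2)) => //.
  exact: exprn_continuous.
have /(IVT ab ch)[x] : Num.min (hfun a) (hfun b) <= y <= Num.max (hfun a) (hfun b).
  by rewrite ge_min le_max ha hb orbT.
rewrite in_itv /= => /andP[ax _] <-.
by exists x => //; exact: lt_le_trans ax.
Qed.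

Lemma hinvP (y : R) : 0 < y -> 0 < hinv y /\ hfun (hinv y) = y.
Proof.
move=> y0; have [x x0 xy] := hfun_surj y0.
have yim : [set hfun x | x in [set x : R | 0 < x]] y by exists x.
split; last by apply: pinvK; rewrite inE.
have surj : set_surj [set x : R | 0 < x] [set y : R | 0 < y] (@hfun R).
  by move=> z /hfun_surj [x' x'0 <-]; exists x'.
by apply: (surjpinv_image_sub surj); exists y.
Qed.

(** In each of the three regimes the radius is chosen so that the exponent of
[chi] at [eps ^ p] is [- ln (C / beta)]; this logarithm is positive as
[beta < C]. *)
Lemma chi_eps_radius (d : nat) p C c beta rho (N : nat) :
  1 <= p -> 0 < c -> 0 < beta -> beta < C -> 0 < rho -> (0 < N)%N ->
  0 < eps_radius d p C c N beta rho /\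
  chi d p C c N (eps_radius d p C c N beta rho `^ p) rho = beta.
Proof.
move=> p1 c0 beta0 betaC rho0 N0.
have p0 : 0 < p by exact: lt_le_trans p1.
have C0 : 0 < C by exact: lt_trans betaC.
have N0' : 0 < N%:R :> R by rewrite ltr0n.
rewrite /eps_radius /chi; set l := ln _.
have l0 : 0 < l by rewrite exp.ln_gt0// ltr_pdivlMr// mul1r.
have lE : C * expR (- l) = beta.
  by rewrite expRN lnK ?posrE ?divr_gt0// invf_div mulrC divfK// gt_eqF.
have lc0 : 0 < l / c by rewrite divr_gt0.
have goal (x : R) : c * N%:R * x = l -> C * expR (- c * N%:R * x) = beta.
  by move=> xl; rewrite !mulNr xl.
have powRK (u q r : R) : 0 <= u -> q * r = 1 -> (u `^ q) `^ r = u.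
  by move=> u0 qr; rewrite -powRrM qr powRr1.
have powRVK (u q r : R) : 0 <= u -> q * r = 1 -> (u `^ q)^-1 `^ r = u^-1.
  by move=> u0 qr; rewrite -powRN -powRrM mulNr qr powRN powRr1.
have sqr_powR (u : R) : 0 <= u -> (u `^ p) ^+ 2 = u `^ (2 * p).
  by move=> u0; rewrite -powR_mulrn ?powR_ge0// -powRrM mulrC.
case: ifPn => [dp|dp].
  have e0 : 0 < (l / c) `^ (1 / (2 * p)) * (rho / N%:R `^ (1 / (2 * p))).
    by rewrite mulr_gt0 ?divr_gt0 ?powR_gt0.
  split => //; apply: goal; rewrite sqr_powR ?(ltW e0)//.
  have pp : 1 / (2 * p) * (2 * p) = 1 by rewrite div1r mulVf// mulf_neq0// gt_eqF.
  rewrite powRM ?divr_ge0 ?powR_ge0 ?(ltW rho0)// powRK ?(ltW lc0)//.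
  rewrite powRM ?invr_ge0 ?powR_ge0 ?(ltW rho0)//.
  rewrite powRVK ?(ltW N0')//.
  have r0 : rho `^ (2 * p) != 0 by rewrite gt_eqF// powR_gt0.
  by field; rewrite r0 !gt_eqF.
case: ifPn => [/eqP dp'|dp'].
  have [] := hinvP (y := l / (c * N%:R)); first by rewrite divr_gt0// mulr_gt0.
  set x := hinv _ => x0 hx.
  have e0 : 0 < x `^ (1 / p) * rho by rewrite mulr_gt0// powR_gt0.
  split => //; apply: goal.
  rewrite powRM ?powR_ge0 ?(ltW rho0)// powRK ?(ltW x0) ?divfK ?gt_eqF//.
  have r0 : rho `^ p != 0 by rewrite gt_eqF// powR_gt0.
  rewrite -sqr_powR ?(ltW rho0)//.
  have -> : rho `^ p / (x * rho `^ p) = 1 / x by field; rewrite r0 gt_eqF.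
  have ln0 : ln (2 + 1 / x) != 0.
    by rewrite gt_eqF// exp.ln_gt0// ltr_pwDr ?ler1n// divr_gt0.
  have -> : (x * rho `^ p) ^+ 2 / (rho `^ p ^+ 2 * ln (2 + 1 / x) ^+ 2) = hfun x.
    by rewrite /hfun; field; rewrite r0 ln0.
  by rewrite hx; field; rewrite !gt_eqF.
have d0 : 0 < d%:R :> R.
  have : p < d%:R / 2 by rewrite lt_neqAle dp' leNgt.
  by move=> /(lt_trans p0); rewrite pmulr_lgt0.
have e0 : 0 < (l / c) `^ (1 / d%:R) * (rho / N%:R `^ (1 / d%:R)).
  by rewrite mulr_gt0 ?divr_gt0 ?powR_gt0.
split => //; apply: goal.
have dd : 1 / d%:R * d%:R = 1 :> R by rewrite divfK// gt_eqF.
rewrite -powRrM [p * _]mulrCA divff ?gt_eqF// mulr1.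
rewrite powRM ?divr_ge0 ?powR_ge0 ?(ltW rho0)// powRK ?(ltW lc0)//.
rewrite powRM ?invr_ge0 ?powR_ge0 ?(ltW rho0)//.
rewrite powRVK ?(ltW N0')//.
rewrite powR_mulrn ?(ltW rho0)//.
have r0 : rho ^+ d != 0 by rewrite gt_eqF// exprn_gt0.
by field; rewrite r0 !gt_eqF.
Qed.

Lemma eps_radius_ge0 (d : nat) p C c beta rho (N : nat) : 0 <= rho ->
  0 <= eps_radius d p C c N beta rho.
Proof.
by move=> r0; rewrite /eps_radius; case: ifP => _; [|case: ifP => _];
  rewrite mulr_ge0 ?divr_ge0 ?powR_ge0.
Qed.

Lemma le_eps_radius (d : nat) p C c beta rho rho' (N : nat) : rho <= rho' ->
  eps_radius d p C c N beta rho <= eps_radius d p C c N beta rho'.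
Proof.
move=> r; rewrite /eps_radius; case: ifP => _; [|case: ifP => _];
  by rewrite ler_wpM2l ?powR_ge0// ler_wpM2r ?invr_ge0 ?powR_ge0.
Qed.

End radius.

(** * The error of the numerical flow *)

Section sum_integral.
Context (R : realType).

(** As [g] increases, [g j] is at most its integral over [[j, j + 1]]. *)
Lemma sum_le_Rintegral (g : R -> R) n : measurable_fun setT g ->
  (forall s, 0 <= g s) ->
  (forall s t, 0 <= s -> s <= t -> g s <= g t) ->
  \sum_(1 <= j < n.+1) g j%:R <=
  \int[@lebesgue_measure R]_(s in `[1, n.+1%:R]) g s.
Proof.
move=> mg g0 gmono.
have bounded (h : R -> R) (a b M : R) : measurable_fun setT h ->
    (forall s, a <= s -> s <= b -> `|h s| <= M) ->
    (@lebesgue_measure R).-integrable `[a, b] (EFin \o h).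
  move=> mh hM; apply: measurable_bounded_integrable => //=.
  - by rewrite lebesgue_measure_itv /=; case: ifP => _; rewrite -?EFinB ltry.
  - exact: measurable_funS mh.
  - exists M; split; first exact: num_real.
    move=> x Mx y /=; rewrite in_itv /= => /andP[ay yb].
    by rewrite (le_trans _ (ltW Mx))// hM.
have intg (a b : R) : 0 <= a ->
    (@lebesgue_measure R).-integrable `[a, b] (EFin \o g).
  move=> a0; apply: (bounded _ _ _ (g b)) => // s /(le_trans a0) s0 sb.
  by rewrite ger0_norm// gmono.
elim: n => [|n IH].
  by rewrite big_geq//; apply: Rintegral_ge0.
rewrite big_nat_recr//=.
have n12 : n.+1%:R <= n.+2%:R :> R by rewrite ler_nat.
have n1 : 1 <= n.+1%:R :> R by rewrite ler1n.
have i12 := intg 1 n.+2%:R ler01.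
have := Rintegral_itvB (x := n.+1%:R) i12.
rewrite !bnd_simp => /(_ n1 n12) /eqP; rewrite subr_eq addrC => /eqP ->.
rewrite lerD//.
rewrite Rintegral_itv_obnd_cbnd; last first.
  apply: integrableS (intg n.+1%:R n.+2%:R _) => //.
  by apply: subset_itv; rewrite bnd_simp.
apply: (@le_trans _ _
  (\int[@lebesgue_measure R]_(s in `[n.+1%:R, n.+2%:R]) g n.+1%:R)).
  rewrite (@Rintegral_cst _ _ _ (@lebesgue_measure R) `[n.+1%:R, n.+2%:R]
    (measurable_itv _) (g n.+1%:R)) /=.
  rewrite lebesgue_measure_itv /= lte_fin ltr_nat ltnSn.
  by rewrite -EFinB /= -natrB// subSnn mulr1.
apply: le_Rintegral => //; [|exact: intg|].
  by apply: (bounded _ _ _ `|g n.+1%:R|).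
by move=> s /=; rewrite in_itv /= => /andP[ns _]; exact: gmono.
Qed.

Lemma bar_eps_ge0 (p Kf L Delta : R) N : 0 <= Kf -> 0 <= bar_eps p Kf L N Delta.
Proof. by move=> K0; rewrite /bar_eps mulr_ge0// powR_ge0. Qed.

(** The sample of index [k] is [N.-1 - k] steps older than the last one.  Counted
from the last sample, the bounds on the errors are the values of an increasing
function at the integers, starting with the value [0] at [0]. *)
Lemma mean_flow_error_le (p Kf L Delta : R) (N : nat) (e : nat -> R) :
  1 <= p -> 0 < Kf -> 0 < L -> 0 < Delta -> (0 < N)%N ->
  (forall k, (k < N)%N ->
    0 <= e k <= Kf * (expR (L * Delta * (N.-1 - k)%:R) - 1)) ->
  N%:R^-1 * \sum_(k < N) e k `^ p <= bar_eps p Kf L N Delta `^ p.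
Proof.
move=> p1 K0 L0 D0 N0 eN; have p0 : 0 < p by exact: lt_le_trans p1.
pose g s := (expR (L * Delta * s) - 1) `^ p.
have LD0 : 0 < L * Delta by rewrite mulr_gt0.
have h0 s : 0 <= s -> 0 <= expR (L * Delta * s) - 1.
  by move=> s0; rewrite subr_ge0 -[leLHS]expR0 ler_expR mulr_ge0// ltW.
rewrite /bar_eps powRM ?powR_ge0 ?(ltW K0)//.
rewrite -powRrM div1r mulVf ?gt_eqF// powRr1; last first.
  by rewrite mulr_ge0 ?invr_ge0// Rintegral_ge0// => s _; exact: powR_ge0.
rewrite mulrCA ler_wpM2l ?invr_ge0//.
case: N N0 eN => // n _ eN.
apply: (@le_trans _ _ (Kf `^ p * \sum_(1 <= j < n.+1) g j%:R)); last first.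
  rewrite ler_wpM2l ?powR_ge0//; apply: sum_le_Rintegral.
  - apply: (measurableT_comp (measurable_powR p)); apply: measurable_funB => //.
    by apply: (measurableT_comp (@measurable_expR R)); exact: measurable_funM.
  - by move=> s; exact: powR_ge0.
  - move=> s t s0 st; rewrite ge0_ler_powR ?nnegrE ?h0 ?(ltW p0) ?(le_trans s0)//.
    by rewrite lerD2r ler_expR ler_wpM2l// ltW.
have -> : \sum_(1 <= j < n.+1) g j%:R = \sum_(0 <= j < n.+1) g j%:R.
  by rewrite [RHS]big_ltn// /g mulr0 expR0 subrr powR0 ?add0r// gt_eqF.
rewrite big_mkord (reindex_inj rev_ord_inj) /= mulr_sumr ler_sum// => k _.
rewrite subSS -powRM ?(ltW K0) ?h0//.
have kn : (k <= n)%N by rewrite -ltnS.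
have /eN /andP[] : (n - k < n.+1)%N by rewrite ltnS leq_subr.
rewrite subKn// => e0 ele.
by apply: ge0_ler_powR => //; rewrite ?nnegrE ?(ltW p0)// (le_trans e0).
Qed.

End sum_integral.

(** * Concentration of the empirical measure *)

Section point_masses.
Context (R : realType) (d : nat).
Local Notation V := 'rV[R]_d.

(** No point is close to both [a] and [b], so some ball of positive mass has to
be transported over a distance of at least [r]. *)
Lemma wasserstein_one_point_lb (mu : probability V R) (a b : V) (p : R) :
  1 <= p -> supp mu a -> supp mu b -> a != b ->
  exists2 e : R, 0 < e & forall x : nat -> V,
    (e%:E <= wasserstein p (uniform 1 x) mu `^ p)%E.
Proof.
move=> p1 sa sb ab; have p0 : 0 < p by exact: lt_le_trans p1.
pose r := enorm (a - b) / 4.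
have r0 : 0 < r.
  rewrite divr_gt0// (lt_le_trans _ (norm_le_enorm _))// normr_gt0 subr_eq0.
  exact: ab.
pose B (v : V) : set V := [set z | enorm (v - z) < r].
have mB v : measurable (B v) by apply: measurable_open; exact: open_enorm_ball.
have B0 v : supp mu v -> (0 < mu (B v))%E.
  move=> sv; apply: (sv _ (open_enorm_ball (x := v) (r := r))).
  by rewrite /= subrr /enorm big1 ?sqrtr0// => i _; rewrite mxE expr0n.
pose m := Num.min (fine (mu (B a))) (fine (mu (B b))).
have finB v : mu (B v) \is a fin_num by exact: fin_num_measure.
have m0 : 0 < m.
  by rewrite lt_min !fine_gt0 ?B0 ?ltey_eq ?finB.
exists (r `^ p * m); first by rewrite mulr_gt0 ?powR_gt0.
move=> x; rewrite wasserstein_powR//.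
have [v [farv mv]] : exists v, 2 * r <= enorm (x 0 - v) /\ (m%:E <= mu (B v))%E.
  have [xa|xa] := leP (2 * r) (enorm (x 0 - a)).
    by exists a; split => //; rewrite -(fineK (finB a)) lee_fin ge_min lexx.
  exists b; split; last by rewrite -(fineK (finB b)) lee_fin ge_min lexx orbT.
  have := ler_enormD (a - x 0) (x 0 - b); rewrite subrKA (enormB a (x 0)).
  have : enorm (a - b) = 4 * r by rewrite /r mulrC divfK.
  by move=> ->; move: xa; lra.
apply: le_ereal_inf_tmp => _ [pi cpi <-].
have mx := measurable_point (x 0).
pose D : set (V * V) := [set x 0] `*` B v.
have mD : measurable D by exact: measurableX.
have piD : (mu (B v) <= pi D)%E.
  have [_ <-] := cpi _ (mB v).
  have [x0c _] := cpi _ (measurableC mx).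
  have : pi ((~` [set x 0]) `*` setT) = 0%E.
    by rewrite x0c uniformE big_ord1 indicE memNset ?mulr0//= => /(_ erefl).
  move=> x0c0.
  have mT : measurable ((~` [set x 0]) `*` setT : set (V * V)).
    by apply: measurableX => //; exact: measurableC.
  have := measureU2 pi mD mT.
  rewrite [X in (_ + X)%E]x0c0 adde0; apply: le_trans.
  apply: le_measure; rewrite ?inE.
  - exact: measurableX.
  - exact: measurableU.
  - move=> z [_ Bz]; have [zx|zx] := pselect (z.1 = x 0); first by left; split.
    by right; split.
apply: (@le_trans _ _ (\int[pi]_(z in D) (r `^ p)%:E)%E).
  rewrite integral_cst// EFinM lee_wpmul2l ?lee_fin ?powR_ge0//.
  exact: le_trans piD.
apply: (@le_trans _ _ (\int[pi]_(z in D) (enorm (z.1 - z.2) `^ p)%:E)%E).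
  apply: ge0_le_integral => //.
  - by move=> z _; rewrite lee_fin powR_ge0.
  - by apply/measurable_EFinP; exact: measurable_funS (measurable_cost p).
  - move=> z [/= -> Bz]; rewrite lee_fin.
    rewrite ge0_ler_powR ?nnegrE ?enorm_ge0 ?(ltW r0) ?(ltW p0)//.
    have := ler_enormD (x 0 - z.2) (z.2 - v); rewrite subrKA (enormB z.2).
    by move: Bz; rewrite /B /=; move: farv; lra.
apply: ge0_subset_integral => //.
- by apply/measurable_EFinP; exact: measurable_cost.
- by move=> z _; rewrite lee_fin powR_ge0.
Qed.

Definition pair_with (a : V) (z : V) : V * V := (a, z).

Lemma measurable_pair_with a : measurable_fun setT (pair_with a).
Proof. exact: measurable_fun_pair. Qed.

HB.instance Definition _ a :=
  isMeasurableFun.Build _ _ _ _ (pair_with a) (measurable_pair_with a).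

(** The coupling is the image of [mu] under [z |-> (a, z)]. *)
Lemma wasserstein_dirac (mu : probability V R) (a : V) (p : R) N (x : nat -> V) :
  1 <= p -> (0 < N)%N -> mu (~` [set a]) = 0%E ->
  (forall k, (k < N)%N -> x k = a) ->
  wasserstein p (uniform N x) mu = 0%E.
Proof.
move=> p1 N0 mua xa; have p0 : 0 < p by exact: lt_le_trans p1.
apply/eqP; rewrite eq_le wasserstein_ge0 andbT.
rewrite (wasserstein_le _ _ p1 (lexx 0)) powR0 ?gt_eqF//.
apply: ereal_inf_lbound.
exists (distribution mu (pair_with a)).
  move=> A mA; split; last first.
    by rewrite /distribution /pushforward; congr (mu _); apply/seteqP; split=> z //= [].
  rewrite uniformE (eq_bigr (fun=> \1_A a)) => [|k _]; last by rewrite xa.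
  rewrite sumr_const card_ord -[\1_A a *+ N]mulr_natr mulrCA.
  rewrite mulVf ?mulr1 ?pnatr_eq0 -?lt0n//.
  rewrite indicE; transitivity (mu (pair_with a @^-1` (A `*` setT))) => //.
  have [aA|aA] := boolP (a \in A).
    rewrite (_ : _ @^-1` _ = setT) ?probability_setT//.
    by apply/seteqP; split=> z //= _; split => //; exact: set_mem.
  rewrite (_ : _ @^-1` _ = set0) ?measure0//.
  by rewrite -subset0 => z [/= + _]; rewrite notin_setE in aA.
have mc : measurable_fun setT (fun z : V * V => (enorm (z.1 - z.2) `^ p)%:E).
  by apply/measurable_EFinP; exact: measurable_cost.
rewrite (ge0_integral_pushforward (measurable_pair_with a) _ measurableT mc); last first.
  by move=> z _; rewrite lee_fin powR_ge0.
have mca : measurable_fun setT (fun z : V => (enorm (a - z) `^ p)%:E).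
  exact: measurableT_comp mc (measurable_pair_with a).
rewrite preimage_setT.
rewrite (ge0_negligible_integral (measurableC (measurable_point a))
  measurableT mca _ mua).
  rewrite setDE setCK setTI; apply: integral0_eq => z /= ->.
  rewrite subrr /enorm big1 => [|i _]; last by rewrite mxE expr0n.
  by rewrite sqrtr0 powR0// gt_eqF.
by move=> z _; rewrite lee_fin powR_ge0.
Qed.

End point_masses.

Section concentration.
Context (R : realType) (d : nat).
Local Notation V := 'rV[R]_d.

Lemma diam_ge0 (S : set V) : 0 <= diam S.
Proof.
rewrite /diam; set E := [set _ | _ in _].
have [supE|] := pselect (has_sup E); last by move=> /sup_out ->.
case: (supE) => [[y Ey] ubE]; apply: le_trans (ub_le_sup ubE Ey).
by case: Ey => z _ <-.
Qed.

Lemma dist_le_diam (S : set V) (x y : V) : compact S -> S x -> S y ->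
  `|x - y| <= diam S.
Proof.
move=> /compact_bounded[M [_ SM]] Sx Sy; apply: ub_le_sup; last by exists (x, y).
exists ((M + 1) + (M + 1)) => _ [z [/= Sz1 Sz2] <-].
rewrite (le_trans (ler_normB _ _))// lerD//.
- by apply: SM Sz1; rewrite ltrDl.
- by apply: SM Sz2; rewrite ltrDl.
Qed.

Lemma le_diam (S S' : set V) : compact S' -> S `<=` S' -> diam S <= diam S'.
Proof.
move=> cS' SS'; have [->|/set0P[x Sx]] := eqVneq S set0.
  by rewrite {1}/diam set0X image_set0 sup0 diam_ge0.
apply: ge_sup; first by exists `|x - x|; exists (x, x).
by move=> _ [z [/= Sz1 Sz2] <-]; apply: dist_le_diam => //; exact: SS'.
Qed.

Lemma supp_nonempty (mu : probability V R) : supp mu !=set0.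
Proof.
apply/set0P/eqP => mu0.
have : mu setT = 0%E by rewrite -setC0 -mu0; exact: supp_full.
by rewrite probability_setT => -[] /eqP; rewrite oner_eq0.
Qed.

Lemma supp_diam0 (mu : probability V R) : compact (supp mu) ->
  diam (supp mu) = 0 -> exists a, supp mu = [set a].
Proof.
move=> cmu diam0; have [a sa] := supp_nonempty mu; exists a.
apply/seteqP; split => [x sx|x ->//]; apply/eqP.
by rewrite -subr_eq0 -normr_le0 -diam0 dist_le_diam.
Qed.

Lemma supp_diam_gt0 (mu : probability V R) : compact (supp mu) ->
  0 < diam (supp mu) -> exists a b, [/\ supp mu a, supp mu b & a != b].
Proof.
move=> cmu; apply: contraPP => /forallNP nab; apply/negP; rewrite -leNgt.
have [a sa] := supp_nonempty mu.
apply: ge_sup; first by exists `|a - a|; exists (a, a).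
move=> _ [[x y] [/= sx sy] <-]; rewrite normr_le0 subr_eq0.
by apply/negPn/negP => xy; apply: (nab x); exists y.
Qed.

Context disp (Omega : measurableType disp) (P : probability Omega R).
Context (mu : probability V R) (X : nat -> {mfun Omega >-> V}).

Lemma iid_narrow (m n : nat) : (m <= n)%N -> iid P mu n X -> iid P mu m X.
Proof.
move=> mn [law indep]; split => [i /andP[i1 im]|J A uJ Jm mA].
  by apply: law; rewrite i1 (leq_trans im).
by apply: indep => // i /Jm /andP[-> /leq_trans->].
Qed.

Lemma chi_le_C (p C c : R) (N : nat) (eps rho : R) :
  0 < C -> 0 < c -> 0 <= rho -> chi d p C c N eps rho <= C.
Proof.
move=> C0 c0 rho0.
have bound (u : R) : 0 <= u -> C * expR (- c * N%:R * u) <= C.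
  move=> u0; rewrite ger_pMr// -[leRHS]expR0 ler_expR.
  by rewrite mulr_le0_ge0// mulr_le0_ge0// oppr_le0 ltW.
rewrite /chi; case: ifP => _; [|case: ifP => _]; apply: bound.
- by rewrite divr_ge0 ?sqr_ge0 ?powR_ge0.
- by rewrite divr_ge0 ?sqr_ge0// mulr_ge0 ?powR_ge0 ?sqr_ge0.
- by rewrite divr_ge0 ?powR_ge0 ?exprn_ge0.
Qed.

(** A law with two points in its support is at least some fixed distance away
from every one-point empirical measure, so the deviation bound for one sample
and a small [eps] bounds the mass of the whole space. *)
Lemma concentration_constant_ge1 (p C c : R) (N : nat) :
  1 <= p -> 0 < C -> 0 < c -> concentration_constants d p C c ->
  compact (supp mu) -> 0 < diam (supp mu) -> (0 < N)%N -> iid P mu N X ->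
  1 <= C.
Proof.
move=> p1 C0 c0 Cc cmu dmu N0 iidX.
have [a [b [sa sb ab]]] := supp_diam_gt0 cmu dmu.
have [e e0 He] := wasserstein_one_point_lb p1 sa sb ab.
have := Cc _ _ P mu X 1 e cmu (divr_gt0 dmu (ltr0Sn R 1)) isT e0 (iid_narrow N0 iidX).
set S := [set w | _]; have -> : S = setT.
  apply/seteqP; split=> // w _; rewrite /S /= empiricalE//; exact: He.
rewrite probability_setT lee_fin => /le_trans; apply.
by apply: chi_le_C => //; rewrite divr_ge0// ltW.
Qed.

(** If the support is a point, all samples are equal to it almost surely and the
distance vanishes.  Otherwise the deviation inequality applies at
[eps_radius `^ p], where [chi] is [beta]. *)
Lemma concentration_event (p C c beta rho : R) (N : nat) :
  1 <= p -> 0 < C -> 0 < c -> concentration_constants d p C c ->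
  0 < beta -> beta < 1 -> compact (supp mu) -> diam (supp mu) / 2 <= rho ->
  (0 < N)%N -> iid P mu N X ->
  exists A : set Omega, [/\ measurable A, ((1 - beta)%:E <= P A)%E &
    forall w, A w -> (wasserstein p (uniform N (fun k => X k.+1 w)) mu
      <= (eps_radius d p C c N beta rho)%:E)%E].
Proof.
move=> p1 C0 c0 Cc b0 b1 cmu drho N0 iidX; have p0 : 0 < p by exact: lt_le_trans p1.
have := diam_ge0 (supp mu); rewrite le_eqVlt => /orP[/eqP/esym dmu|dmu].
  have [a sa] := supp_diam0 cmu dmu.
  have mua : mu (~` [set a]) = 0%E by rewrite -sa supp_full.
  pose B k := X k.+1 @^-1` (~` [set a]).
  have mB k : measurable (B k).
    rewrite -[X in measurable X]setTI; apply: measurable_funP => //.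
    by apply: measurableC; exact: measurable_point.
  have PB k : (k < N)%N -> P (B k) = 0%E.
    case: iidX => law _ kN; rewrite -mua.
    by rewrite -(law k.+1)//; apply: measurableC; exact: measurable_point.
  have mU : measurable (\bigcup_(k in [set k | (k < N)%N]) B k).
    exact: bigcup_measurable.
  have PU : P (\bigcup_(k in [set k | (k < N)%N]) B k) = 0%E.
    apply: (measure_negligible mU).
    rewrite bigcup_mkcond; apply: negligible_bigcup => k.
    case: ifPn => [|_]; last exact: negligible_set0.
    by rewrite inE /= => kN; apply/negligibleP => //; exact: PB.
  exists (~` \bigcup_(k in [set k | (k < N)%N]) B k); split.
  - exact: measurableC.
  - by rewrite probability_setC// PU sube0 lee_fin lerBlDr lerDl ltW.
  - move=> w wB; rewrite (wasserstein_dirac p1 N0 mua) ?lee_fin.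
      by apply: eps_radius_ge0; apply: le_trans drho; rewrite dmu mul0r.
    move=> k kN; apply: contrapT => Xa; apply: wB; exists k => //.
have C1 := concentration_constant_ge1 p1 C0 c0 Cc cmu dmu N0 iidX.
have rho0 : 0 < diam (supp mu) / 2 by rewrite divr_gt0.
have [e0 chi_e] := chi_eps_radius d p1 c0 b0 (lt_le_trans b1 C1) rho0 N0.
set e := eps_radius _ _ _ _ _ _ _ in e0 chi_e.
pose S := [set w | (wasserstein p (uniform N (fun k => X k.+1 w)) mu < e%:E)%E].
have mS : measurable S := measurable_wasserstein_lt (fun k => X k.+1) e N mu p1.
have eE (w : \bar R) : (0 <= w)%E -> (((e `^ p)%:E <= w `^ p)%E = (e%:E <= w)%E).
  move=> w0; apply/idP/idP => [|ew].
    apply: contraTT; rewrite -!ltNge => we.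
    have wfin : w \is a fin_num by rewrite ge0_fin_numE// (lt_trans we) ?ltry.
    move: we w0; rewrite -(fineK wfin) poweR_EFin !lte_fin lee_fin => we w0.
    by rewrite gt0_ltr_powR ?nnegrE ?(ltW e0).
  by rewrite -poweR_EFin gt0_ler_poweR ?in_itv /= ?leey ?lee_fin ?w0 ?(ltW e0)
    ?(ltW p0).
have empE w : empirical 1 N (X ^~ w) = uniform N (fun k => X k.+1 w).
  by rewrite empiricalE// subnK//; congr uniform; apply/funext => k; rewrite addn1.
exists S; split => //.
- have := Cc _ _ P mu X N (e `^ p) cmu rho0 N0 (powR_gt0 _ e0) iidX.
  rewrite chi_e => PS.
  rewrite -[S]setCK probability_setC; last exact: measurableC.
  rewrite EFinB leeB//; apply: le_trans PS; rewrite le_eqVlt; apply/orP; left.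
  apply/eqP; congr (P _); apply/funext => w; apply/propext.
  by rewrite /S /= empE eE ?wasserstein_ge0// leNgt; split => /negP.
- move=> w /ltW /le_trans; apply; rewrite lee_fin; exact: le_eps_radius.
Qed.

End concentration.

(** * Propagated samples *)

Section transport_of_laws.
Context (R : realType) (d : nat).
Local Notation V := 'rV[R]_d.

Lemma supp_distribution (mu : probability V R) (f : {mfun V >-> V}) (K : set V) :
  continuous f -> compact K -> supp mu `<=` K ->
  supp (distribution mu f) `<=` f @` K.
Proof.
move=> cf cK muK y sy; apply: contrapT => yK.
have cfK : closed (f @` K).
  apply: compact_closed; first exact: norm_hausdorff.
  by apply: continuous_compact => //; exact: continuous_subspaceT.
have oU : open (~` (f @` K)) by rewrite openC.
have : (mu (f @^-1` (~` (f @` K))) <= mu (~` supp mu))%E.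
  apply: le_measure; rewrite ?inE.
  - rewrite -[X in measurable X]setTI.
    by apply: measurable_funP => //; exact: measurable_open.
  - by apply: measurableC; apply: measurable_closed; exact: supp_closed.
  - by move=> x /= fx sx; apply: fx; exists x => //; exact: muK.
rewrite [X in (_ <= X)%E]supp_full leNgt => /negP; apply.
exact: sy.
Qed.

(** The sequence is shifted because the concentration inequality numbers its
samples from [1], while the used ones start at [m]. *)
Lemma iid_comp disp (Omega : measurableType disp) (P : probability Omega R)
    (mu : probability V R) (f : {mfun V >-> V}) (m n : nat)
    (X : nat -> {mfun Omega >-> V}) : (1 <= m <= n)%N -> iid P mu n X ->
  iid P (distribution mu f) (n - m + 1)
    (fun k => (f \o X (k.-1 + m)%N : {mfun Omega >-> V})).
Proof.
move=> /andP[m1 mn] [law indep].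
have range k : (1 <= k <= n - m + 1)%N -> (1 <= k.-1 + m <= n)%N by lia.
have mf A : measurable A -> measurable (f @^-1` A).
  by move=> mA; rewrite -[X in measurable X]setTI; exact: measurable_funP.
split=> [k /range kn A mA|J A uJ Jn mA].
  exact: (law _ kn _ (mf _ mA)).
pose J' := [seq (k.-1 + m)%N | k <- J].
pose A' i := f @^-1` A (i - m).+1.
have idx k : k \in J -> ((k.-1 + m) - m).+1 = k.
  by move=> /Jn; rewrite addnK => /andP[k1 _]; rewrite prednK.
have uJ' : uniq J'.
  rewrite map_inj_in_uniq// => k k' kJ k'J kk'.
  by rewrite -(idx _ kJ) -(idx _ k'J) kk'.
have J'n i : i \in J' -> (1 <= i <= n)%N by move=> /mapP[k /Jn/range + ->].
have mA' i : i \in J' -> measurable (A' i).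
  by move=> /mapP[k kJ ->]; rewrite /A' idx//; apply: mf; exact: mA.
have := indep J' A' uJ' J'n mA'.
rewrite big_map (_ : \bigcap_(i in [set` J']) _ =
    \bigcap_(k in [set` J]) ((f \o X (k.-1 + m)%N) @^-1` A k)); last first.
  apply/seteqP; split => [w Hw k kJ|w Hw _ /mapP[k kJ ->]].
    have := Hw (k.-1 + m)%N (map_f _ kJ).
    by rewrite /A' /= idx.
  by have := Hw k kJ; rewrite /A' /= idx.
move=> ->; rewrite big_seq [RHS]big_seq; apply: eq_bigr => k kJ.
by rewrite /A' idx.
Qed.

End transport_of_laws.

Section sampling_times.
Context (R : realType) (T Delta : R) (t : nat -> R) (n : nat).
Hypothesis t1_ge0 : 0 <= t 1%N.
Hypothesis t_mono : forall i, (2 <= i <= n)%N -> t i.-1 <= t i.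
Hypothesis t_gap : forall i, (2 <= i <= n)%N -> t i - t i.-1 <= Delta.
Hypothesis t_last : t n = T.

Lemma sampling_time_ge0 i : (1 <= i <= n)%N -> 0 <= t i.
Proof.
elim: i => // -[_ _|i IH /andP[_ ilen]]; first exact: t1_ge0.
apply: le_trans (IH _) (t_mono (i := i.+2) _); last exact: ilen.
by rewrite /= ltnW.
Qed.

Lemma sampling_time_le i : (1 <= i <= n)%N -> t i <= T <= t i + (n - i)%:R * Delta.
Proof.
clear t1_ge0; move=> /andP[i1 ilen]; rewrite -{1 2}(subKn ilen).
have : (n - i < n)%N by lia.
elim: (n - i)%N => [|j IH] jn; first by rewrite subn0 t_last mul0r addr0 lexx.
have jn' : (2 <= n - j <= n)%N by lia.
have /andP[jT Tj] := IH (ltnW jn).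
rewrite subnS (le_trans (t_mono jn') jT) /=; apply: le_trans Tj _.
have := t_gap jn'; rewrite -[j.+1%:R]natr1; lra.
Qed.

End sampling_times.

Unset Implicit Arguments.

Theorem mainTheorem2 (R : realType) (d : nat)
  (* dynamics *)
  (F : R -> 'rV[R]_d -> 'rV[R]_d)
  (F_cont : continuous_field F)
  (F_lip : locally_lipschitz_field F)
  (F_complete : forward_complete F)
  (* random initial conditions, xi0 1, ..., xi0 Nbar *)
  (disp : measure_display) (Omega : measurableType disp)
  (P : probability Omega R)
  (Pxi0 : probability 'rV[R]_d R)
  (Nbar : nat) (xi0 : nat -> {mfun Omega >-> 'rV[R]_d})
  (xi0_iid : iid P Pxi0 Nbar xi0)
  (K : set 'rV[R]_d) (K_compact : compact K) (Pxi0_supp : supp Pxi0 `<=` K)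
  (* sampling times *)
  (T Delta : R) (t : nat -> R)
  (Delta_gt0 : 0 < Delta)
  (t1_ge0 : 0 <= t 1%N)
  (t_mono : forall i, (2 <= i <= Nbar)%N -> t i.-1 <= t i)
  (t_gap : forall i, (2 <= i <= Nbar)%N -> t i - t i.-1 <= Delta)
  (t_last : t Nbar = T)
  (* numerical flow *)
  (Phinum : R -> R -> 'rV[R]_d -> 'rV[R]_d) (Kf L : R)
  (Kf_gt0 : 0 < Kf) (L_gt0 : 0 < L)
  (Phinum_err : forall s u : R, 0 <= s -> s <= u -> u <= T ->
     forall x, (flow F s 0 @` K) x ->
     enorm (Phinum u s x - flow F u s x) <= Kf * (expR (L * (u - s)) - 1))
  (* samples used *)
  (Nflat N : nat) (Nflat_range : (1 <= Nflat <= Nbar)%N)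
  (N_def : N = (Nbar - Nflat + 1)%N)
  (beta p : R) (beta_gt0 : 0 < beta) (beta_lt1 : beta < 1) (p_ge1 : 1 <= p)
  (* constants of the concentration inequality for this p and d *)
  (C c : R) (C_gt0 : 0 < C) (c_gt0 : 0 < c)
  (Cc : concentration_constants d p C c) :
  let rhoT := diam (flow F T 0 @` K) / 2 in
  let PxiT := pushforward Pxi0 (flow F T 0) in
  let barxi w i := Phinum T (t i) (flow F (t i) 0 (xi0 i w)) in
  ((1 - beta)%:E <=
   inner_prob P
     [set w | wasserstein p (empirical Nflat Nbar (barxi w)) PxiT
              <= (psi d p C c Kf L N beta rhoT Delta)%:E])%E.
Proof.
cbv zeta; pose rhoT := diam (flow F T 0 @` K) / 2.
pose barxi w i := Phinum T (t i) (flow F (t i) 0 (xi0 i w)).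
have [Nflat1 NflatN] := andP Nflat_range.
have N_gt0 : (0 < N)%N by rewrite N_def addn1.
have range k : (k < N)%N -> (1 <= k + Nflat <= Nbar)%N.
  move=> kN; rewrite addn_gt0 Nflat1 orbT /= -[leqRHS](subnK NflatN) leq_add2r.
  by move: kN; rewrite N_def addn1 ltnS.
have t_ge0 := sampling_time_ge0 t1_ge0 t_mono.
have t_le := sampling_time_le t_mono t_gap t_last.
have T0 : 0 <= T.
  by rewrite -t_last; apply: t_ge0; rewrite (leq_trans Nflat1)/=.
have flowT_cont : continuous (flow F T 0) by exact: flow_continuous.
pose f : {mfun 'rV[R]_d >-> 'rV[R]_d} := HB.pack (flow F T 0)
  (isMeasurableFun.Build _ _ _ _ _ (continuous_measurable_rV flowT_cont)).
pose mu := distribution Pxi0 f.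
change ((1 - beta)%:E <= inner_prob P
  [set w | wasserstein p (empirical Nflat Nbar (barxi w)) mu
           <= (psi d p C c Kf L N beta rhoT Delta)%:E])%E.
have supp_mu : supp mu `<=` flow F T 0 @` K.
  exact: (@supp_distribution _ _ Pxi0 f K flowT_cont K_compact Pxi0_supp).
have K'_compact : compact (flow F T 0 @` K).
  by apply: continuous_compact => //; exact: continuous_subspaceT.
have supp_compact : compact (supp mu).
  by apply: (subclosed_compact _ K'_compact supp_mu); exact: supp_closed.
have rho_le : diam (supp mu) / 2 <= rhoT.
  by rewrite ler_wpM2r// le_diam.
have iidX := iid_comp f Nflat_range xi0_iid; rewrite -N_def in iidX.
have [A [mA PA WA]] := concentration_event p_ge1 C_gt0 c_gt0 Cc beta_gt0
  beta_lt1 supp_compact rho_le N_gt0 iidX.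
(* Phinum is controlled only from points of the flow of K, which contains all
   samples outside a null set. *)
have mK : measurable (~` K).
  apply: measurableC; apply: measurable_closed.
  apply: compact_closed; [exact: norm_hausdorff|exact: K_compact].
have PK : Pxi0 (~` K) = 0%E.
  apply: (measure_negligible mK); exists (~` supp Pxi0); split.
  - by apply: measurableC; apply: measurable_closed; exact: supp_closed.
  - exact: supp_full.
  - exact: subsetC Pxi0_supp.
pose B i := if (1 <= i <= Nbar)%N then xi0 i @^-1` (~` K) else set0.
have mB i : measurable (B i).
  rewrite /B; case: ifP => // _.
  by rewrite -[X in measurable X]setTI; apply: measurable_funP.
have mU : measurable (\bigcup_i B i) by exact: bigcupT_measurable.
have PU : P (\bigcup_i B i) = 0%E.
  apply: (measure_negligible mU); apply: negligible_bigcup => i.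
  apply/negligibleP => //; rewrite /B; case: ifP => [iN|_]; last by rewrite measure0.
  case: xi0_iid => law _; rewrite -PK; exact: law.
have mAU : measurable (A `\` \bigcup_i B i) by exact: measurableD.
apply: (@le_trans _ _ (P (A `\` \bigcup_i B i))).
  apply: (le_trans PA); rewrite -[leRHS]adde0 -PU.
  apply: le_trans (measureU2 P mAU mU); apply: le_measure; rewrite ?inE//.
    exact: measurableU.
  by move=> w Aw; have [Uw|Uw] := pselect ((\bigcup_i B i) w); [right|left].
apply: ereal_sup_ubound; exists (A `\` \bigcup_i B i) => //; split => //.
move=> w [Aw Uw] /=.
have xi0K i : (1 <= i <= Nbar)%N -> K (xi0 i w).
  move=> iN; apply: contrapT => Kx; apply: Uw; exists i => //.
  by rewrite /B iN.
rewrite empiricalE// -N_def /psi.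
apply: (wasserstein_move p_ge1 _ _ (WA w Aw)).
- by apply: eps_radius_ge0; apply: le_trans rho_le; rewrite divr_ge0// diam_ge0.
- by apply: bar_eps_ge0; exact: ltW.
apply: (@mean_flow_error_le _ p Kf L Delta N (fun k =>
  enorm (flow F T 0 (xi0 (k + Nflat)%N w) - barxi w (k + Nflat)%N))) => // k kN.
rewrite enorm_ge0 /=.
have kr := range k kN; have /andP[tT Tt] := t_le _ kr; have t0 := t_ge0 _ kr.
rewrite enormB /barxi 
  -(flow_comp (xi0 (k + Nflat)%N w) F_lip F_complete (lexx 0) t0 tT).
apply: (@le_trans _ _ (Kf * (expR (L * (T - t (k + Nflat)%N)) - 1))).
  by apply: Phinum_err => //; exists (xi0 (k + Nflat)%N w) => //; exact: xi0K.
rewrite ler_pM2l// lerD2r ler_expR -mulrA ler_pM2l// lerBlDl mulrC.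
rewrite (_ : (N.-1 - k)%N = (Nbar - (k + Nflat))%N)//.
by rewrite N_def addn1 /= -subnDA addnC.
Qed.
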